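(* For every oriented link $L$ in $S^3$, \[ V_{1,L}(t_0,t_1)=\mathrm{LG}_L(t_0,t_1)\in\mathbb{Z}[t_0^{\pm1},t_1^{\pm1}]. \]
   Context: Braid group conventions: $B_n$ is the Artin braid group with standard generators $s_1,\dots,s_{n-1}$ (relations $s_is_{i+1}s_i=s_{i+1}s_is_{i+1}$ and $s_is_j=s_js_i$ for $|i-j|\ge2$). Here $s_i$ is the crossing in which strand $i$ passes over strand $i+1$, and $\overline{s}_i=s_i^{-1}$. Link invariants from enhanced $R$-matrices: let $U$ be a finite-dimensional vector space with ordered basis $(u_1,\dots,u_m)$, write $u_{ij}=u_i\otimes u_j$, let $R\in\mathrm{End}(U\otimes U)$ be an invertible solution of the braid (Yang–Baxter) relation, and let $h\in\mathrm{End}(U)$. Let $\rho_R:B_n\to GL(U^{\otimes n})$ send $s_i\mapsto \mathrm{id}^{\otimes(i-1)}\otimes R\otimes\mathrm{id}^{\otimes(n-i-1)}$. If the oriented link $L$ is the closure of $\beta\in B_n$, its invariant is \[ \frac{1}{\dim U}\,\mathrm{tr}\big((\mathrm{id}_U\otimes h^{\otimes(n-1)})\circ\rho_R(\beta)\big), \] which (for the pairs $(R,h)$ below) depends only on the oriented link $L$. The Links--Gould invariant $\mathrm{LG}_L(t_0,t_1)$ is obtained from $U=W$ with basis $(w_1,w_2,w_3,w_4)$ over $\mathbb{Q}(t_0^{1/2},t_1^{1/2},Y)$, $Y=\sqrt{(t_0-1)(1-t_1)}$, with $h_{\mathrm{LG}}=\mathrm{diag}(t_0^{-1},-t_1,-t_0^{-1},t_1)$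 and $R_{\mathrm{LG}}$ given by: $R(w_{11})=t_0w_{11}$, $R(w_{12})=t_0^{1/2}w_{21}$, $R(w_{13})=t_0^{1/2}w_{31}$, $R(w_{14})=w_{41}$, $R(w_{21})=t_0^{1/2}w_{12}+(t_0-1)w_{21}$, $R(w_{22})=-w_{22}$, $R(w_{23})=(t_0t_1-1)w_{23}-t_0^{1/2}t_1^{1/2}w_{32}-t_0^{1/2}t_1^{1/2}Yw_{41}$, $R(w_{24})=t_1^{1/2}w_{42}$, $R(w_{31})=t_0^{1/2}w_{13}+(t_0-1)w_{31}$, $R(w_{32})=-t_0^{1/2}t_1^{1/2}w_{23}+Yw_{41}$, $R(w_{33})=-w_{33}$, $R(w_{34})=t_1^{1/2}w_{43}$, $R(w_{41})=w_{14}-t_0^{1/2}t_1^{1/2}Yw_{23}+Yw_{32}+Y^2w_{41}$, $R(w_{42})=t_1^{1/2}w_{24}+(t_1-1)w_{42}$, $R(w_{43})=t_1^{1/2}w_{34}+(t_1-1)w_{43}$, $R(w_{44})=t_1w_{44}$. The $V_1$-polynomial $V_{1,L}(t_0,t_1)$ is obtained from $U=V$ with basis $(v_1,v_2,v_3,v_4)$ over $\mathbb{Q}(t_0,t_1)$, with $h_V=\mathrm{diag}(-1,1,1,-1)$ and $R_V$ given by: $R(v_{11})=-v_{11}$, $R(v_{12})=-t_0v_{21}$, $R(v_{13})=-t_1v_{31}$, $R(v_{14})=-t_0t_1v_{41}$, $R(v_{21})=-v_{12}+(t_0-1)v_{21}$, $R(v_{22})=t_0v_{22}$, $R(v_{23})=-t_1v_{32}+(t_0-1)t_1v_{41}$,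 $R(v_{24})=t_0t_1v_{42}$, $R(v_{31})=-v_{13}+(t_1-1)v_{31}$, $R(v_{32})=-t_1^{-1}v_{23}+(1-t_0)v_{41}$, $R(v_{33})=t_1v_{33}$, $R(v_{34})=v_{43}$, $R(v_{41})=-v_{14}+(t_1^{-1}-1)v_{23}+(t_1-1)v_{32}+(t_0+t_1-2)v_{41}$, $R(v_{42})=t_1^{-1}v_{24}+(t_0-1)v_{42}$, $R(v_{43})=t_1v_{34}+(t_1-1)v_{43}$, $R(v_{44})=-v_{44}$. *)

(* Defs.v *)
From HB Require Import structures.
From mathcomp Require Import all_boot all_order all_algebra.
Set Implicit Arguments. Unset Strict Implicit. Unset Printing Implicit Defensive.
Import Order.TTheory GRing.Theory Num.Theory.
Local Open Scope ring_scope.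

Section Invariants.
Variable F : fieldType.

(* Conventions.
   - Basis vectors u_1..u_4 are represented by ordinals 0..3 of 'I_4.
   - A coefficient table  c i j k l  (1-based nats) is the coefficient of
     u_k (x) u_l in R(u_i (x) u_j).
   - A basis vector of U^{(x) n} is a word  w : n.-tuple 'I_4.
   - An operator on U^{(x) n} is a kernel  A : state -> state -> F,
     A w' w = coefficient of w' in A(w). *)

Definition RLG (s0 s1 Y : F) (i j k l : nat) : F :=
  let t0 := s0 ^+ 2 in let t1 := s1 ^+ 2 in
  match i, j, k, l with
  | 1, 1, 1, 1 => t0
  | 1, 2, 2, 1 => s0
  | 1, 3, 3, 1 => s0
  | 1, 4, 4, 1 => 1
  | 2, 1, 1, 2 => s0
  | 2, 1, 2, 1 => t0 - 1
  | 2, 2, 2, 2 => -1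
  | 2, 3, 2, 3 => t0 * t1 - 1
  | 2, 3, 3, 2 => - (s0 * s1)
  | 2, 3, 4, 1 => - (s0 * s1 * Y)
  | 2, 4, 4, 2 => s1
  | 3, 1, 1, 3 => s0
  | 3, 1, 3, 1 => t0 - 1
  | 3, 2, 2, 3 => - (s0 * s1)
  | 3, 2, 4, 1 => Y
  | 3, 3, 3, 3 => -1
  | 3, 4, 4, 3 => s1
  | 4, 1, 1, 4 => 1
  | 4, 1, 2, 3 => - (s0 * s1 * Y)
  | 4, 1, 3, 2 => Y
  | 4, 1, 4, 1 => Y ^+ 2
  | 4, 2, 2, 4 => s1
  | 4, 2, 4, 2 => t1 - 1
  | 4, 3, 3, 4 => s1
  | 4, 3, 4, 3 => t1 - 1
  | 4, 4, 4, 4 => t1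
  | _, _, _, _ => 0
  end.

Definition RV (t0 t1 : F) (i j k l : nat) : F :=
  match i, j, k, l with
  | 1, 1, 1, 1 => -1
  | 1, 2, 2, 1 => - t0
  | 1, 3, 3, 1 => - t1
  | 1, 4, 4, 1 => - (t0 * t1)
  | 2, 1, 1, 2 => -1
  | 2, 1, 2, 1 => t0 - 1
  | 2, 2, 2, 2 => t0
  | 2, 3, 3, 2 => - t1
  | 2, 3, 4, 1 => (t0 - 1) * t1
  | 2, 4, 4, 2 => t0 * t1
  | 3, 1, 1, 3 => -1
  | 3, 1, 3, 1 => t1 - 1
  | 3, 2, 2, 3 => - t1^-1
  | 3, 2, 4, 1 => 1 - t0
  | 3, 3, 3, 3 => t1
  | 3, 4, 4, 3 => 1
  | 4, 1, 1, 4 => -1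
  | 4, 1, 2, 3 => t1^-1 - 1
  | 4, 1, 3, 2 => t1 - 1
  | 4, 1, 4, 1 => t0 + t1 - 2
  | 4, 2, 2, 4 => t1^-1
  | 4, 2, 4, 2 => t0 - 1
  | 4, 3, 3, 4 => t1
  | 4, 3, 4, 3 => t1 - 1
  | 4, 4, 4, 4 => -1
  | _, _, _, _ => 0
  end.

(* The 16x16 matrix of R in the basis u_{ij} (index 4(i-1)+(j-1));
   entry (a, b) = coefficient of basis vector a in R(basis vector b). *)
Definition Rmx (c : nat -> nat -> nat -> nat -> F) : 'M[F]_16 :=
  \matrix_(a < 16, b < 16)
    c (b %/ 4).+1 (b %% 4).+1 (a %/ 4).+1 (a %% 4).+1.

Definition Rcoef (c : nat -> nat -> nat -> nat -> F) (eps : bool)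
    (i j k l : 'I_4) : F :=
  if eps then c i.+1 j.+1 k.+1 l.+1
  else invmx (Rmx c) (inord (4 * k + l)) (inord (4 * i + j)).

Definition state (n : nat) := (n.-tuple 'I_4)%type.
Definition op (n : nat) := state n -> state n -> F.

Definition letter {n} (w : state n) (p : nat) : 'I_4 := nth ord0 w p.

Definition idop n : op n := fun w' w => (w' == w)%:R.
Definition compop n (A B : op n) : op n :=
  fun w' w => \sum_(u : state n) A w' u * B u w.

(* rho_R(s_{p+1}^{eps}) acting on strands p, p+1 (0-based). *)
Definition genop n (c : nat -> nat -> nat -> nat -> F) (g : nat * bool) : op n :=
  fun w' w =>
    let p := g.1 in
    ([forall q : 'I_n, ((q : nat) != p) && ((q : nat) != p.+1) ==>
                        (letter w' q == letter w q)])%:R *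
    Rcoef c g.2 (letter w p) (letter w p.+1) (letter w' p) (letter w' p.+1).

(* A braid word in B_n: a list of letters (p, eps) standing for
   s_{p+1} if eps = true and s_{p+1}^{-1} if eps = false (so p is 0-based,
   and we require p.+1 < n).  The word g_1 g_2 ... g_m acts as
   rho(g_1) o rho(g_2) o ... o rho(g_m). *)
Definition braid_word (n : nat) (b : seq (nat * bool)) : bool :=
  all (fun g : nat * bool => (g.1.+1 < n)%N) b.

Definition braidop n c (b : seq (nat * bool)) : op n :=
  foldr (fun g A => compop (@genop n c g) A) (@idop n) b.

(* (1/dim U) tr((id (x) h^{(x)(n-1)}) o rho_R(beta)), with h diagonal with
   entries h 1, ..., h 4. *)
Definition invariant n (c : nat -> nat -> nat -> nat -> F) (h : nat -> F)
    (b : seq (nat * bool)) : F :=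
  (4%:R)^-1 * \sum_(w : state n)
     (\prod_(q < n | (0 < (q : nat))%N) h (letter w q).+1) * @braidop n c b w w.

Definition hLG (s0 s1 : F) (i : nat) : F :=
  match i with
  | 1 => (s0 ^+ 2)^-1 | 2 => - s1 ^+ 2 | 3 => - (s0 ^+ 2)^-1 | 4 => s1 ^+ 2
  | _ => 0 end.

Definition hV (i : nat) : F :=
  match i with 1 => -1 | 2 => 1 | 3 => 1 | 4 => -1 | _ => 0 end.

(* LG of the closure of b in B_n, with t0 = s0^2, t1 = s1^2. *)
Definition LGinv (s0 s1 Y : F) n b := @invariant n (RLG s0 s1 Y) (hLG s0 s1) b.
Definition V1inv (t0 t1 : F) n b := @invariant n (RV t0 t1) hV b.

(* Value at (x0, x1) of the Laurent polynomial p(t0,t1) / (t0 t1)^k,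
   p in Z[t0][t1] (outer variable t0). *)
Definition laurent_eval (p : {poly {poly int}}) (k : nat) (x0 x1 : F) : F :=
  (map_poly (fun q : {poly int} => (map_poly (fun z : int => z%:~R) q).[x1]) p).[x0]
  / (x0 * x1) ^+ k.

End Invariants.

(* Main.v *)
(** The R-matrix of [V_1] is a Drinfeld twist of the Links--Gould R-matrix by an
    odd root vector.  It has the symmetries [a (x) k + 1 (x) a] and
    [s (x) 1 + K (x) s] with [a^2 = s^2 = 0] and [a s - s a = k - K], and
    [F = 1 + a (x) s] is a 2-cocycle; conjugating [R_V] by [F] yields, up to a
    relabelling of the basis and a diagonal bicharacter twist, [R_LG].  Iterating
    the cocycle gives an intertwiner [Phi] of the two braid group representations.
    Since [Phi = (1 (x) Phi') (1 + a (x) s_rest)], the Links--Gould partial trace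
    over the last [n - 1] strands differs from the one of [V_1] only through [a] on
    the first strand and [s] on the others, and the commutation of a braid with [a],
    together with [a s - s a = k - K], shows that the two agree.  The partial
    trace on the [V_1] side is a scalar, because it commutes with two operators
    with coefficients 1 that act transitively on the basis; this removes the
    factor 1/4 and gives integrality. *)

Require Import Defs.
From HB Require Import structures.
From mathcomp Require Import all_boot all_order all_algebra.
From mathcomp Require Import ring zify.
Import Order.TTheory GRing.Theory Num.Theory.
Local Open Scope ring_scope.

Set Implicit Arguments. Unset Strict Implicit. Unset Printing Implicit Defensive.

(** Shape of the basic step for the intertwiner: [T] is a coproduct term commuting with the crossing
    [C], [E] is the two-strand twist turning [C] into [C'], and [D] acts on the other strands
    only. *)
Lemma conj_chain (A : nzRingType) (D E T C C' : A) :
  T * C = C * T -> E * C = C' * E -> D * C' = C' * D ->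
  D * (E * T) * C = C' * (D * (E * T)).
Proof. by move=> tc ec dc; rewrite -!mulrA tc (mulrA E) ec -!mulrA mulrA dc !mulrA. Qed.

Lemma addr_cancel_cross (A : zmodType) (x y z u v w : A) :
  x + z + (y + u) - (v + y + (z + w)) = x - v + (u - w).
Proof.
rewrite (addrACA x) !opprD (addrACA (x + y)) (addrACA x) (addrACA z) !subrr.
by rewrite addr0 add0r.
Qed.

(** * Sparse tables *)

Section Tables.
Variable F : fieldType.

(* Entries [None] stand for zero, so that products of tables can be computed by
   [cbv] without generating spurious zero summands. *)
Definition tab1 := nat -> nat -> option F.
Definition tab2 := nat -> nat -> nat -> nat -> option F.

Definition oadd (x y : option F) : option F :=
  match x, y with
  | Some a, Some b => Some (a + b) | Some a, None => Some a | None, _ => y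
  end.
Definition omul (x y : option F) : option F :=
  match x, y with Some a, Some b => Some (a * b) | _, _ => None end.
Definition osum4 (f : nat -> option F) : option F :=
  oadd (f 1%N) (oadd (f 2%N) (oadd (f 3%N) (f 4%N))).

Definition id1 : tab1 := fun k i =>
  match k, i with
  | 1, 1 => Some 1 | 2, 2 => Some 1 | 3, 3 => Some 1 | 4, 4 => Some 1
  | _, _ => None
  end.
Definition mul1 (x y : tab1) : tab1 := fun k i =>
  osum4 (fun j => omul (x k j) (y j i)).
Definition add1 (x y : tab1) : tab1 := fun k i => oadd (x k i) (y k i).

(* [c i j k l] is the coefficient of [u_k (x) u_l] in the image of [u_i (x) u_j]. *)
Definition kron (x y : tab1) : tab2 := fun i j k l => omul (x k i) (y l j).
Definition add2 (c c' : tab2) : tab2 := fun i j k l =>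
  oadd (c i j k l) (c' i j k l).
Definition mul2 (c c' : tab2) : tab2 := fun i j k l =>
  osum4 (fun x => osum4 (fun y => omul (c x y k l) (c' i j x y))).

Definition all4 (P : nat -> Prop) : Prop := P 1%N /\ P 2%N /\ P 3%N /\ P 4%N.
(** Two absent entries give [True] rather than [0 = 0], so that a table identity leaves goals only
    where some entry is present. *)
Definition eqo (x y : option F) : Prop :=
  match x, y with None, None => True | _, _ => odflt 0 x = odflt 0 y end.
Definition eqt1 (x y : tab1) := all4 (fun k => all4 (fun i => eqo (x k i) (y k i))).
Definition eqt2 (c c' : tab2) :=
  all4 (fun i => all4 (fun j => all4 (fun k => all4 (fun l =>
    eqo (c i j k l) (c' i j k l))))).

Definition mx1 (x : tab1) : 'M[F]_4 :=
  \matrix_(k, i) odflt 0 (x k.+1 i.+1).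
Definition mx2 (c : tab2) : 'M['M[F]_4]_4 :=
  \matrix_(k, i) \matrix_(l, j) odflt 0 (c i.+1 j.+1 k.+1 l.+1).

Lemma all4P (P : nat -> Prop) : all4 P -> forall i : 'I_4, P i.+1.
Proof. by case=> ? [? [? ?]] [[|[|[|[|?]]]] ?]. Qed.

Lemma eqoP x y : eqo x y -> odflt 0 x = odflt 0 y.
Proof. by case: x y => [x|] [y|]. Qed.

Lemma odflt_add x y : odflt 0 (oadd x y) = odflt 0 x + odflt 0 y.
Proof. by case: x y => [x|] [y|]; rewrite /= ?addr0 ?add0r. Qed.

Lemma odflt_mul x y : odflt 0 (omul x y) = odflt 0 x * odflt 0 y.
Proof. by case: x y => [x|] [y|]; rewrite /= ?mulr0 ?mul0r. Qed.

Lemma odflt_sum4 f : odflt 0 (osum4 f) = \sum_(i < 4) odflt 0 (f i.+1).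
Proof. by rewrite /osum4 !odflt_add !big_ord_recl big_ord0 addr0. Qed.

Lemma eq_mx1 x y : eqt1 x y -> mx1 x = mx1 y.
Proof.
move=> exy; apply/matrixP=> k i; rewrite !mxE; apply: eqoP.
by have /all4P/(_ k)/all4P/(_ i) := exy.
Qed.

Lemma eq_mx2 c c' : eqt2 c c' -> mx2 c = mx2 c'.
Proof.
move=> ecc; apply/matrixP=> k i; rewrite !mxE; apply/matrixP=> l j; rewrite !mxE.
by apply: eqoP; have /all4P/(_ i)/all4P/(_ j)/all4P/(_ k)/all4P/(_ l) := ecc.
Qed.

Lemma mx1M x y : mx1 (mul1 x y) = mx1 x * mx1 y.
Proof.
apply/matrixP=> k i; rewrite !mxE odflt_sum4; apply: eq_bigr => j _.
by rewrite odflt_mul !mxE.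
Qed.

Lemma mx1D x y : mx1 (add1 x y) = mx1 x + mx1 y.
Proof. by apply/matrixP=> k i; rewrite !mxE odflt_add. Qed.

Lemma mx1_add0 x y : eqt1 (add1 x y) (fun _ _ => None) -> mx1 x = - mx1 y.
Proof.
move=> /eq_mx1; rewrite mx1D => E; apply/eqP; rewrite -addr_eq0 E.
by apply/eqP/matrixP=> i j; rewrite !mxE.
Qed.

Lemma mx1_1 : mx1 id1 = 1.
Proof. by apply/matrixP=> -[[|[|[|[|?]]]] ?] [[|[|[|[|?]]]] ?]; rewrite !mxE. Qed.

Lemma mx2M c c' : mx2 (mul2 c c') = mx2 c * mx2 c'.
Proof.
apply/matrixP=> k i; rewrite !mxE; apply/matrixP=> l j; rewrite !mxE.
rewrite odflt_sum4 summxE; apply: eq_bigr => x _.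
rewrite !mxE odflt_sum4; apply: eq_bigr => y _.
by rewrite odflt_mul !mxE.
Qed.

Lemma mx2D c c' : mx2 (add2 c c') = mx2 c + mx2 c'.
Proof.
by apply/matrixP=> k i; rewrite !mxE; apply/matrixP=> l j; rewrite !mxE odflt_add.
Qed.

(* Each of these generates a symmetry of the R-matrix of [V], with coproducts
   [aV (x) kV + 1 (x) aV] (equivalently [aV (x) 1 + kV (x) aV]),
   [bV (x) 1 + lV (x) bV] and [sV (x) 1 + KV (x) sV]. *)
Definition aV : tab1 := fun k i =>
  match k, i with 2, 1 => Some 1 | 4, 3 => Some 1 | _, _ => None end.
Definition bV : tab1 := fun k i =>
  match k, i with 1, 3 => Some 1 | 2, 4 => Some 1 | _, _ => None end.
Definition sV (t0 t1 : F) : tab1 := fun k i =>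
  match k, i with 1, 2 => Some (t0 - 1) | 3, 4 => Some (t1^-1 - 1) | _, _ => None end.
Definition diag1 (a b c d : F) : tab1 := fun k i =>
  match k, i with
  | 1, 1 => Some a | 2, 2 => Some b | 3, 3 => Some c | 4, 4 => Some d
  | _, _ => None
  end.
Definition kV : tab1 := diag1 1 (-1) 1 (-1).
Definition KV (t0 t1 : F) : tab1 := diag1 t0 (- t0) t1^-1 (- t1^-1).
Definition lV (t1 : F) : tab1 := diag1 t1 t1 (- t1) (- t1).

Definition tRV (t0 t1 : F) : tab2 := fun i j k l =>
  match i, j, k, l with
  | 1, 1, 1, 1 => Some (-1)
  | 1, 2, 2, 1 => Some (- t0)
  | 1, 3, 3, 1 => Some (- t1)
  | 1, 4, 4, 1 => Some (- (t0 * t1))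
  | 2, 1, 1, 2 => Some (-1)
  | 2, 1, 2, 1 => Some (t0 - 1)
  | 2, 2, 2, 2 => Some t0
  | 2, 3, 3, 2 => Some (- t1)
  | 2, 3, 4, 1 => Some ((t0 - 1) * t1)
  | 2, 4, 4, 2 => Some (t0 * t1)
  | 3, 1, 1, 3 => Some (-1)
  | 3, 1, 3, 1 => Some (t1 - 1)
  | 3, 2, 2, 3 => Some (- t1^-1)
  | 3, 2, 4, 1 => Some (1 - t0)
  | 3, 3, 3, 3 => Some t1
  | 3, 4, 4, 3 => Some 1
  | 4, 1, 1, 4 => Some (-1)
  | 4, 1, 2, 3 => Some (t1^-1 - 1)
  | 4, 1, 3, 2 => Some (t1 - 1)
  | 4, 1, 4, 1 => Some (t0 + t1 - 2)
  | 4, 2, 2, 4 => Some (t1^-1)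
  | 4, 2, 4, 2 => Some (t0 - 1)
  | 4, 3, 3, 4 => Some t1
  | 4, 3, 4, 3 => Some (t1 - 1)
  | 4, 4, 4, 4 => Some (-1)
  | _, _, _, _ => None
  end.

(** Closed form of the inverse of [tRV], certified by [tV_inv]. Having it as a table lets symmetries
    and integrality of negative crossings be checked entry by entry too. *)
Definition tRVi (t0 t1 : F) : tab2 := fun i j k l =>
  match i, j, k, l with
  | 1, 1, 1, 1 => Some (-1)
  | 1, 2, 2, 1 => Some (-1)
  | 1, 2, 1, 2 => Some (t0^-1 - 1)
  | 1, 3, 3, 1 => Some (-1)
  | 1, 3, 1, 3 => Some (t1^-1 - 1)
  | 1, 4, 4, 1 => Some (-1)
  | 1, 4, 3, 2 => Some (t1 - 1)
  | 1, 4, 2, 3 => Some (t1^-1 - 1)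
  | 1, 4, 1, 4 => Some (t0^-1 + t1^-1 - 2)
  | 2, 1, 1, 2 => Some (- t0^-1)
  | 2, 2, 2, 2 => Some (t0^-1)
  | 2, 3, 3, 2 => Some (- t1)
  | 2, 3, 1, 4 => Some (1 - t0^-1)
  | 2, 4, 4, 2 => Some t1
  | 2, 4, 2, 4 => Some (t0^-1 - 1)
  | 3, 1, 1, 3 => Some (- t1^-1)
  | 3, 2, 2, 3 => Some (- t1^-1)
  | 3, 2, 1, 4 => Some ((t0^-1 - 1) * t1^-1)
  | 3, 3, 3, 3 => Some (t1^-1)
  | 3, 4, 4, 3 => Some (t1^-1)
  | 3, 4, 3, 4 => Some (t1^-1 - 1)
  | 4, 1, 1, 4 => Some (- (t0^-1 * t1^-1))
  | 4, 2, 2, 4 => Some (t0^-1 * t1^-1)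
  | 4, 3, 3, 4 => Some 1
  | 4, 4, 4, 4 => Some (-1)
  | _, _, _, _ => None
  end.

(* The Links--Gould R-matrix with the two occurrences of [Y] in off-diagonal
   positions replaced by independent [u] and [d]. *)
Definition tLG (s0 s1 u d : F) : tab2 := fun i j k l =>
  let t0 := s0 ^+ 2 in let t1 := s1 ^+ 2 in
  match i, j, k, l with
  | 1, 1, 1, 1 => Some t0
  | 1, 2, 2, 1 => Some s0
  | 1, 3, 3, 1 => Some s0
  | 1, 4, 4, 1 => Some 1
  | 2, 1, 1, 2 => Some s0
  | 2, 1, 2, 1 => Some (t0 - 1)
  | 2, 2, 2, 2 => Some (-1)
  | 2, 3, 2, 3 => Some (t0 * t1 - 1)
  | 2, 3, 3, 2 => Some (- (s0 * s1))
  | 2, 3, 4, 1 => Some (- (s0 * s1 * u))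
  | 2, 4, 4, 2 => Some s1
  | 3, 1, 1, 3 => Some s0
  | 3, 1, 3, 1 => Some (t0 - 1)
  | 3, 2, 2, 3 => Some (- (s0 * s1))
  | 3, 2, 4, 1 => Some u
  | 3, 3, 3, 3 => Some (-1)
  | 3, 4, 4, 3 => Some s1
  | 4, 1, 1, 4 => Some 1
  | 4, 1, 2, 3 => Some (- (s0 * s1 * d))
  | 4, 1, 3, 2 => Some d
  | 4, 1, 4, 1 => Some (u * d)
  | 4, 2, 2, 4 => Some s1
  | 4, 2, 4, 2 => Some (t1 - 1)
  | 4, 3, 3, 4 => Some s1
  | 4, 3, 4, 3 => Some (t1 - 1)
  | 4, 4, 4, 4 => Some t1
  | _, _, _, _ => None
  end.

Definition tLGi (s0 s1 u d : F) : tab2 := fun i j k l =>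
  let t0 := s0 ^+ 2 in let t1 := s1 ^+ 2 in
  match i, j, k, l with
  | 1, 1, 1, 1 => Some (t0^-1)
  | 1, 2, 2, 1 => Some (s0^-1)
  | 1, 2, 1, 2 => Some (t0^-1 - 1)
  | 1, 3, 3, 1 => Some (s0^-1)
  | 1, 3, 1, 3 => Some (t0^-1 - 1)
  | 1, 4, 4, 1 => Some 1
  | 1, 4, 2, 3 => Some (d / (s0 * s1))
  | 1, 4, 3, 2 => Some (- (d / (t0 * t1)))
  | 1, 4, 1, 4 => Some (u * d / (t0 * t1))
  | 2, 1, 1, 2 => Some (s0^-1)
  | 2, 2, 2, 2 => Some (-1)
  | 2, 3, 3, 2 => Some (- (s0 * s1)^-1)
  | 2, 3, 1, 4 => Some (u / (s0 * s1))
  | 2, 4, 4, 2 => Some (s1^-1)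
  | 2, 4, 2, 4 => Some (t1^-1 - 1)
  | 3, 1, 1, 3 => Some (s0^-1)
  | 3, 2, 2, 3 => Some (- (s0 * s1)^-1)
  | 3, 2, 3, 2 => Some ((t0 * t1)^-1 - 1)
  | 3, 2, 1, 4 => Some (- (u / (t0 * t1)))
  | 3, 3, 3, 3 => Some (-1)
  | 3, 4, 4, 3 => Some (s1^-1)
  | 3, 4, 3, 4 => Some (t1^-1 - 1)
  | 4, 1, 1, 4 => Some 1
  | 4, 2, 2, 4 => Some (s1^-1)
  | 4, 3, 3, 4 => Some (s1^-1)
  | 4, 4, 4, 4 => Some (t1^-1)
  | _, _, _, _ => None
  end.

(* [v_i] is matched with [w_(sgm i)]. *)
Definition sgm (i : nat) : nat :=
  (match i with 1 => 3 | 2 => 1 | 3 => 4 | 4 => 2 | _ => 0 end)%N.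

(* A bicharacter for the grading by charges, in which
   [w_1 (x) w_4] and [w_2 (x) w_3] have the same charge. *)
Definition chi (s0 s1 : F) (i j : nat) : F :=
  match i, j with
  | 1, 2 => s0 * s1 ^+ 2 | 1, 3 => - s0^-1 | 1, 4 => - s1 ^+ 2
  | 2, 3 => (s0 * s1)^-1 | 2, 4 => (s0 * s1)^-1
  | 4, 2 => (s0 * s1 ^+ 2)^-1 | 4, 3 => - s1^-1 | 4, 4 => - (s0 * s1 ^+ 3)^-1
  | _, _ => 1
  end.

Definition twist (s0 s1 : F) (c : tab2) : tab2 := fun i j k l =>
  match c (sgm i) (sgm j) (sgm k) (sgm l) with
  | Some x => Some (x * chi s0 s1 (sgm i) (sgm j) / chi s0 s1 (sgm k) (sgm l))
  | None => None
  end.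

End Tables.

Arguments id1 {F}. Arguments aV {F}. Arguments bV {F}. Arguments kV {F}.

Ltac check_table :=
  cbv beta iota zeta delta [eqt1 eqt2 all4 eqo oadd omul osum4 id1 mul1 add1 kron add2 mul2 odflt oapp
       aV bV sV diag1 kV KV lV tRV tRVi tLG tLGi sgm chi twist];
  repeat match goal with |- _ /\ _ => apply: conj | |- True => exact: I end.

(** * Operators on tensor powers *)

Section Operators.
Variable F : fieldType.

(** Scalars enter through a central ring morphism, which is all that tensor products over [F]
    require. The structure passes from [A] to 4 x 4 matrices over [A], so it can be iterated. *)
Record centralAlg := CentralAlg {
  car :> nzRingType;
  inj : {rmorphism F -> car};
  injC : forall x y, inj x * y = y * inj x }.

Lemma base_injC (x y : F) : idfun x * y = y * idfun x.
Proof. exact: mulrC. Qed.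

Lemma scalar_injC (A : centralAlg) x (y : 'M[A]_4) :
  (@scalar_mx A 4 \o inj A) x * y = y * (@scalar_mx A 4 \o inj A) x.
Proof.
apply/matrixP=> i j; rewrite /= -!mulmxE mul_scalar_mx !mxE injC (bigD1 j) //=.
rewrite big1 ?addr0 ?mxE ?eqxx //= => k /negPf nkj.
by rewrite mxE nkj mulr0.
Qed.

Definition baseAlg := @CentralAlg F idfun base_injC.
Definition mxAlg (A : centralAlg) :=
  @CentralAlg 'M[A]_4 (@scalar_mx A 4 \o inj A) (@scalar_injC A).

(* [alg n] is the algebra of operators on the n-fold tensor power, presented as
   iterated 4 x 4 matrices, the outermost one acting on the first factor. *)
Fixpoint alg (n : nat) : centralAlg := if n is m.+1 then mxAlg (alg m) else baseAlg.

Section Tensor.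
Variable A : centralAlg.
Implicit Types (x : 'M[F]_4) (y z : A) (c : 'M['M[F]_4]_4).

Definition tens x y : 'M[A]_4 := \matrix_(i, j) (inj A (x i j) * y).

Lemma tensM x y x' y' : tens x y * tens x' y' = tens (x * x') (y * y').
Proof.
apply/matrixP=> i k; rewrite !mxE rmorph_sum mulr_suml; apply: eq_bigr => j _.
by rewrite !mxE rmorphM -!mulrA [y * _]mulrA -(injC _ y) !mulrA.
Qed.

Lemma tensDl x x' y : tens (x + x') y = tens x y + tens x' y.
Proof. by apply/matrixP=> i j; rewrite !mxE rmorphD mulrDl. Qed.

Lemma tensDr x y y' : tens x (y + y') = tens x y + tens x y'.
Proof. by apply/matrixP=> i j; rewrite !mxE mulrDr. Qed.

Lemma tensNl x y : tens (- x) y = - tens x y.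
Proof. by apply/matrixP=> i j; rewrite !mxE rmorphN mulNr. Qed.

Lemma tensNr x y : tens x (- y) = - tens x y.
Proof. by apply/matrixP=> i j; rewrite !mxE mulrN. Qed.

Lemma tens0l y : tens 0 y = 0.
Proof. by apply/matrixP=> i j; rewrite !mxE rmorph0 mul0r. Qed.

Lemma tens0r x : tens x 0 = 0.
Proof. by apply/matrixP=> i j; rewrite !mxE mulr0. Qed.

Lemma entryD (X Y : 'M[A]_4) i j : (X + Y) i j = X i j + Y i j.
Proof. by rewrite mxE. Qed.

Lemma entryN (X : 'M[A]_4) i j : (- X) i j = - X i j.
Proof. by rewrite mxE. Qed.

Lemma tens11 : tens 1 1 = 1.
Proof. by apply/matrixP=> i j; rewrite !mxE rmorph_nat mulr1. Qed.

Lemma tens1_mulE y (X : 'M[A]_4) i j : (tens 1 y * X) i j = y * X i j.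
Proof.
rewrite mxE (bigD1 i) //= big1 => [|k /negPf nki].
  by rewrite addr0 !mxE eqxx rmorph1 mul1r.
by rewrite !mxE eq_sym nki rmorph0 !mul0r.
Qed.

Lemma mul_tens1E y (X : 'M[A]_4) i j : (X * tens 1 y) i j = X i j * y.
Proof.
rewrite mxE (bigD1 j) //= big1 => [|k /negPf nki].
  by rewrite addr0 !mxE eqxx rmorph1 mul1r.
by rewrite !mxE nki rmorph0 mul0r mulr0.
Qed.

End Tensor.

Definition kr (x y : 'M[F]_4) : 'M['M[F]_4]_4 :=
  \matrix_(k, i) \matrix_(l, j) (x k i * y l j).

Lemma mx2_kron (x y : tab1 F) : mx2 (kron x y) = kr (mx1 x) (mx1 y).
Proof.
by apply/matrixP=> k i; rewrite !mxE; apply/matrixP=> l j; rewrite !mxE odflt_mul.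
Qed.

Lemma krM x y x' y' : kr x y * kr x' y' = kr (x * x') (y * y').
Proof.
apply/matrixP=> k i; rewrite !mxE; apply/matrixP=> l j; rewrite !mxE.
rewrite summxE big_distrl; apply: eq_bigr => p _ /=.
rewrite !mxE big_distrr; apply: eq_bigr => q _ /=.
by rewrite !mxE mulrACA.
Qed.

Lemma kr11 : kr 1 1 = 1.
Proof.
apply/matrixP=> k i; rewrite !mxE; apply/matrixP=> l j; rewrite !mxE.
by case: (k == i); rewrite !mxE ?mul1r ?mul0r.
Qed.

Lemma krDr x y y' : kr x (y + y') = kr x y + kr x y'.
Proof.
by apply/matrixP=> k i; rewrite !mxE; apply/matrixP=> l j; rewrite !mxE mulrDr.
Qed.

Lemma kr0l y : kr 0 y = 0.
Proof.
by apply/matrixP=> k i; rewrite !mxE; apply/matrixP=> l j; rewrite !mxE mul0r.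
Qed.

Section TwoFactors.
Variable A : centralAlg.
Implicit Types (c : 'M['M[F]_4]_4) (z : A).

Definition act2 c : 'M['M[A]_4]_4 := map_mx (map_mx (inj A)) c.
Definition deep z : mxAlg (mxAlg A) := @tens (mxAlg A) 1 (@tens A 1 z).

Lemma act2M c c' : act2 (c * c') = act2 c * act2 c'.
Proof.
apply/matrixP=> k i; rewrite !mxE; apply/matrixP=> l j; rewrite !mxE.
rewrite !summxE rmorph_sum; apply: eq_bigr => p _.
rewrite !mxE rmorph_sum; apply: eq_bigr => q _.
by rewrite !mxE rmorphM.
Qed.

Lemma act2D c c' : act2 (c + c') = act2 c + act2 c'.
Proof.
by apply/matrixP=> k i; rewrite !mxE; apply/matrixP=> l j; rewrite !mxE rmorphD.
Qed.

Lemma act21 : act2 1 = 1.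
Proof.
apply/matrixP=> k i; rewrite !mxE; apply/matrixP=> l j; rewrite !mxE.
by case: (k == i); rewrite !mxE ?rmorph0 // rmorph_nat.
Qed.

Lemma inj_mxAlgE x : inj (mxAlg A) x = tens 1 (inj A x).
Proof.
by apply/matrixP=> i j; rewrite !mxE; case: (i == j); rewrite ?rmorph1 ?rmorph0 ?mul1r ?mul0r.
Qed.

(** Separates the first two factors from the rest. Since [act2] and [deep] commute, identities on
    three blocks reduce to identities of 16 x 16 matrices. *)
Lemma tens2E x y z :
  @tens (mxAlg A) x (@tens A y z) = act2 (kr x y) * deep z.
Proof.
apply/matrixP=> k i; rewrite mul_tens1E [LHS]mxE; apply/matrixP=> l j.
by rewrite mul_tens1E inj_mxAlgE tens1_mulE !mxE rmorphM mulrA.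
Qed.

Lemma act2_deepC c z : GRing.comm (act2 c) (deep z).
Proof.
rewrite /GRing.comm /deep; apply/matrixP=> k i.
rewrite (@mul_tens1E (mxAlg A)) (@tens1_mulE (mxAlg A)); apply/matrixP=> l j.
by rewrite mul_tens1E tens1_mulE !mxE injC.
Qed.

End TwoFactors.
End Operators.

(** * Braid generators, iterated coproducts and the twist *)

Section Generators.
Variable F : fieldType.
Local Notation alg := (@alg F).
Implicit Types (c : 'M['M[F]_4]_4) (g x k l a s : 'M[F]_4).

(** A position with no room for a crossing gives the identity, so the commutation lemmas need no
    bound on [p]. *)
Fixpoint gen c (n p : nat) {struct n} : alg n :=
  match n return alg n with
  | 0 => 1
  | m.+1 =>
    match p with
    | q.+1 => tens 1 (gen c m q)
    | 0 => match m return alg m.+1 with 0 => 1 | m'.+1 => act2 (alg m') c end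
    end
  end.

Fixpoint gl g n : alg n := if n is m.+1 then tens g (gl g m) else 1.

(* The iterated coproduct of an element with coproduct [x (x) k + l (x) x]. *)
Fixpoint prim x k l n : alg n :=
  if n is m.+1 then tens x (gl k m) + tens l (prim x k l m) else 0.

Lemma gl1 n : gl 1 n = 1.
Proof. by elim: n => //= n ->; rewrite tens11. Qed.

Lemma tens_comm (A : centralAlg F) x y (z z' : A) :
  GRing.comm x y -> GRing.comm z z' -> GRing.comm (tens x z) (tens y z').
Proof. by move=> cxy cz; rewrite /GRing.comm !tensM cxy cz. Qed.

Lemma deepM (A : centralAlg F) (y z : A) : deep (y * z) = deep y * deep z.
Proof. by rewrite /deep tensM mulr1 -[1 in LHS]mulr1 -tensM mulr1. Qed.

Lemma gen_gl c g n p : GRing.comm c (kr g g) -> GRing.comm (gen c n p) (gl g n).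
Proof.
move=> ccg; elim: n p => [|n IHn] p; first exact: commr1.
case: p => [|p] /=; last by apply: tens_comm => //; exact/commr_sym/commr1.
case: n {IHn} => [|n] /=; first exact/commr_sym/commr1.
rewrite /GRing.comm tens2E mulrA -act2M ccg act2M -!mulrA.
by congr (_ * _); apply: act2_deepC.
Qed.

(** Seen from two adjacent strands, the iterated coproduct is a sum of terms acting there by
    [k (x) k], by [l (x) l], or by the coproduct of [x]; the three hypotheses treat these in
    turn. *)
Lemma gen_prim c x k l n p :
  GRing.comm c (kr k k) -> GRing.comm c (kr l l) ->
  GRing.comm c (kr x k + kr l x) ->
  GRing.comm (gen c n p) (prim x k l n).
Proof.
move=> ck cl cx; elim: n p => [|n IHn] p; first exact: commr0.
case: p => [|p] /=.
  case: n {IHn} => [|n] /=; first exact/commr_sym/commr1.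
  rewrite tensDr addrA !tens2E -mulrDl -act2D.
  apply: commrD; apply: commrM; try exact: act2_deepC.
    by rewrite /GRing.comm -!act2M cx.
  by rewrite /GRing.comm -!act2M cl.
apply: commrD; apply: tens_comm; rewrite ?/GRing.comm ?mul1r ?mulr1 //.
  exact: gen_gl.
exact: IHn.
Qed.

Section Intertwiner.
Variables (a s k K : 'M[F]_4).
Hypotheses (aa : a * a = 0) (ss : s * s = 0) (sK : s * K = - (K * s)).
Hypothesis (as_sa : a * s - s * a = k - K).

Local Notation S := (prim s 1 K).

Definition twist1 n : alg n.+1 := 1 + tens a (S n).
Definition untwist1 n : alg n.+1 := 1 - tens a (S n).

Fixpoint Phi n : alg n :=
  if n is m.+1 then tens 1 (Phi m) * twist1 m else 1.
Fixpoint Psi n : alg n :=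
  if n is m.+1 then untwist1 m * tens 1 (Psi m) else 1.

(** The iterated coproduct of an odd square-zero element is again square-zero: the mixed terms [s K]
    and [K s] cancel. *)
Lemma SS n : S n * S n = 0.
Proof.
elim: n => [|n IHn] /=; first by rewrite mul0r.
rewrite gl1 mulrDl !mulrDr !tensM ss IHn sK tensNl tens0l tens0r !mul1r !mulr1.
by rewrite add0r addr0 addNr.
Qed.

Lemma tens_aS n : tens a (S n) * tens a (S n) = 0.
Proof. by rewrite tensM aa tens0l. Qed.

Lemma twist1K n : untwist1 n * twist1 n = 1.
Proof.
rewrite /twist1 /untwist1 mulrDr mulr1 mulrBl mul1r.
by rewrite [X in _ + (_ - X)]tens_aS subr0 subrK.
Qed.

Lemma untwist1K n : twist1 n * untwist1 n = 1.
Proof.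
rewrite /twist1 /untwist1 mulrBr mulr1 mulrDl mul1r.
by rewrite [X in _ - (_ + X)]tens_aS addr0 addrK.
Qed.

Lemma Phi_Psi n : Phi n * Psi n = 1.
Proof.
elim: n => [|n IHn] /=; first by rewrite mulr1.
rewrite mulrA -[_ * twist1 n * _]mulrA untwist1K mulr1 tensM IHn mulr1.
exact: tens11.
Qed.

Lemma Psi_Phi n : Psi n * Phi n = 1.
Proof.
elim: n => [|n IHn] /=; first by rewrite mulr1.
rewrite mulrA -[_ * tens 1 (Phi n)]mulrA tensM IHn mulr1 tens11 mulr1.
exact: twist1K.
Qed.

(** The 2-cocycle identity for [1 + a (x) s]. After [a * a = 0] and [S n * S n = 0] remove the
    quadratic terms, what remains is [K + a s = k + s a] in the second factor, which is the bracket
    relation. *)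
Lemma twist_cocycle n :
  (tens 1 (twist1 n) : alg n.+2) * twist1 n.+1 =
  act2 (alg n) (1 + kr a s) * (1 + act2 (alg n) (kr a k + kr 1 a) * deep (S n)).
Proof.
have E1 : (tens 1 (twist1 n) : alg n.+2) = 1 + act2 (alg n) (kr 1 a) * deep (S n).
  by rewrite /twist1 tensDr tens11 tens2E.
have E2 : twist1 n.+1 =
    act2 (alg n) (1 + kr a s) + act2 (alg n) (kr a K) * deep (S n).
  rewrite /twist1 /= gl1 tensDr addrA !tens2E act2D act21.
  by rewrite {1}/deep !tens11 mulr1.
rewrite E1 E2 mulrDl mul1r -addrA [RHS]mulrDr mulr1; congr (_ + _).
rewrite mulrDr -!mulrA.
rewrite -[deep _ * act2 _ (1 + _)]act2_deepC.
rewrite [deep (S n) * (_ * _)]mulrA -[deep _ * act2 _ (kr a K)]act2_deepC.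
rewrite -!mulrA -deepM SS {3}/deep !tens0r !mulr0 addr0.
rewrite !mulrA -!act2M -mulrDl -act2D; congr (act2 _ _ * _).
rewrite mulrDl mul1r mulrDr mulr1 mulrDr !krM aa kr0l !mulr1 !mul1r add0r.
rewrite addrCA -krDr addrAC -krDr addrC; congr (kr _ _ + _).
by apply/eqP; rewrite addrC -subr_eq addrAC as_sa subrK.
Qed.

Variables (c c' : 'M['M[F]_4]_4).
Hypotheses (cK : GRing.comm c (kr K K)).
Hypotheses (cs : GRing.comm c (kr s 1 + kr K s)).
Hypotheses (ca : GRing.comm c (kr a k + kr 1 a)).
Hypothesis (ccF : (1 + kr a s) * c = c' * (1 + kr a s)).

(** For the first crossing, the cocycle identity brings the two-strand twist next to a factor built
    from the coproduct of [a], which commutes with [c]. A later crossing commutes with [a (x) S]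
    because [s] generates a symmetry, and induction applies to the remaining strands. *)
Lemma Phi_gen n p : (p.+1 < n)%N -> Phi n * gen c n p = gen c' n p * Phi n.
Proof.
elim: n p => // n IHn [|p].
  case: n {IHn} => // n _.
  have -> : Phi n.+2 = deep (Phi n) * (tens 1 (twist1 n) * twist1 n.+1).
    by rewrite mulrA /deep (@tensM _ (alg n.+1)) mulr1.
  rewrite twist_cocycle -[gen c _ _]/(act2 (alg n) c) -[gen c' _ _]/(act2 (alg n) c').
  apply: conj_chain.
  - apply/esym/commrD; first exact: commr1.
    by apply: commrM; [rewrite /GRing.comm -!act2M ca | apply: act2_deepC].
  - by rewrite -!act2M ccF.
  - by rewrite act2_deepC.
rewrite ltnS => /IHn IH.
rewrite -[Phi n.+1]/(tens 1 (Phi n) * twist1 n) -[gen c _ _]/(tens 1 (gen c n p)).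
rewrite -[gen c' _ _]/(tens 1 (gen c' n p)) -mulrA.
have -> : twist1 n * tens 1 (gen c n p) = tens 1 (gen c n p) * twist1 n.
  apply/esym/commrD; first exact: commr1.
  apply: tens_comm; first exact/commr_sym/commr1.
  by apply: gen_prim => //; rewrite kr11; apply: commr1.
by rewrite mulrA tensM IH -tensM mulrA.
Qed.
End Intertwiner.
End Generators.

(** * Weighted traces *)

Section Traces.
Variable F : fieldType.
Local Notation alg := (@alg F).
Implicit Types (h m : nat -> F) (x g : 'M[F]_4).

Fixpoint wtr h n : alg n -> F :=
  match n return alg n -> F with
  | 0 => fun X => X
  | n'.+1 => fun X => \sum_(i < 4) h i.+1 * wtr h (X i i : alg n')
  end.

Lemma wtrD h n (X Y : alg n) : wtr h (X + Y) = wtr h X + wtr h Y.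
Proof.
elim: n X Y => //= n IHn X Y; rewrite -big_split; apply: eq_bigr => i _ /=.
by rewrite mxE IHn mulrDr.
Qed.

Lemma wtr0 h n : wtr h (0 : alg n) = 0.
Proof. by elim: n => //= n IHn; apply: big1 => i _; rewrite mxE IHn mulr0. Qed.

Lemma wtrN h n (X : alg n) : wtr h (- X) = - wtr h X.
Proof. by apply/eqP; rewrite eq_sym -subr_eq0 -opprD oppr_eq0 -wtrD subrr wtr0. Qed.

Lemma wtrB h n (X Y : alg n) : wtr h (X - Y) = wtr h X - wtr h Y.
Proof. by rewrite wtrD wtrN. Qed.

Lemma wtr_sum h n I (r : seq I) (X : I -> alg n) :
  wtr h (\sum_(i <- r) X i) = \sum_(i <- r) wtr h (X i).
Proof. by apply: (big_morph (@wtr h n)); [exact: wtrD | exact: wtr0]. Qed.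

Lemma wtr_injl h n y (X : alg n) : wtr h (inj (alg n) y * X) = y * wtr h X.
Proof.
elim: n X => [|n IHn] //= X.
rewrite mulr_sumr; apply: eq_bigr => i _; rewrite mulrCA -IHn.
by congr (_ * wtr _ _); rewrite -[_%:M]/(inj (mxAlg (alg n)) y) inj_mxAlgE tens1_mulE.
Qed.

(** The scalar [e] records parity: 1 for elements that move freely around the weighted trace, -1 for
    those that change its sign. *)
Definition skew_cyclic h (e : F) n (Y : alg n) :=
  forall X : alg n, wtr h (Y * X) = e * wtr h (X * Y).

(** A nonzero entry of [x] joins basis vectors whose weights have ratio [e], so exchanging the two
    summation indices costs exactly this factor, and the factors of the tensor legs multiply. *)
Lemma skew_cyclic_tens h e e' x n (Y : alg n) :
  (forall i j, x i j != 0 -> h i.+1 = e * h j.+1) ->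
  skew_cyclic h e' Y -> skew_cyclic h (e * e') (tens x Y : alg n.+1).
Proof.
move=> xh cY X; rewrite /= mulr_sumr.
under eq_bigr => i _ do rewrite mxE wtr_sum mulr_sumr.
under [RHS]eq_bigr => i _ do rewrite mxE wtr_sum !mulr_sumr.
rewrite exchange_big; apply: eq_bigr => j _; apply: eq_bigr => i _ /=.
rewrite !mxE [X j i * _]mulrA -(injC _ (X j i)) -[inj _ _ * _ * Y]mulrA.
rewrite -[inj _ _ * Y * _]mulrA !wtr_injl cY.
have [->|/xh ->] := eqVneq (x i j) 0; first by rewrite !mul0r !mulr0.
by ring.
Qed.

Lemma skew_cyclicD h e n (Y Z : alg n) :
  skew_cyclic h e Y -> skew_cyclic h e Z -> skew_cyclic h e (Y + Z).
Proof. by move=> cY cZ X; rewrite mulrDl mulrDr !wtrD cY cZ mulrDr. Qed.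

Lemma skew_cyclic1 h n : skew_cyclic h 1 (1 : alg n).
Proof. by move=> X; rewrite mulr1 !mul1r. Qed.

Lemma skew_cyclic0 h e n : skew_cyclic h e (0 : alg n).
Proof. by move=> X; rewrite mul0r mulr0 wtr0 mulr0. Qed.

Lemma skew_cyclicM h e e' n (Y Z : alg n) :
  skew_cyclic h e Y -> skew_cyclic h e' Z -> skew_cyclic h (e * e') (Y * Z).
Proof.
move=> cY cZ X; rewrite -mulrA cY -mulrA cZ.
by rewrite -!mulrA.
Qed.

(** With [D] the diagonal matrix of [h], this says [D x = e x D]. *)
Definition weight h (e : F) x := forall i j, x i j != 0 -> h i.+1 = e * h j.+1.

Lemma weight_diag h (x1 x2 x3 x4 : F) : weight h 1 (mx1 (diag1 x1 x2 x3 x4)).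
Proof.
by move=> [[|[|[|[|?]]]] ?] [[|[|[|[|?]]]] ?] //; rewrite !mxE ?eqxx //= mul1r.
Qed.
Lemma weight_1 h : weight h 1 (1 : 'M[F]_4).
Proof. by rewrite -mx1_1; apply: weight_diag. Qed.

Lemma skew_cyclic_gl h g n : weight h 1 g -> skew_cyclic h 1 (gl g n).
Proof.
move=> hg; elim: n => [|n IHn]; first exact: skew_cyclic1.
by rewrite -[1]mulr1; apply: skew_cyclic_tens.
Qed.

Lemma skew_cyclic_prim h e x k l n :
  weight h e x -> weight h 1 k -> weight h 1 l ->
  skew_cyclic h e (prim x k l n).
Proof.
move=> hx hk hl; elim: n => [|n IHn]; first exact: skew_cyclic0.
apply: skew_cyclicD.
  by rewrite -[e]mulr1; apply: skew_cyclic_tens => //; apply: skew_cyclic_gl.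
by rewrite -[e]mul1r; apply: skew_cyclic_tens.
Qed.

Lemma wtr_gl h m g n (X : alg n) :
  (forall i j, i != j -> g i j = 0) ->
  (forall i : 'I_4, h i.+1 = m i.+1 * g i i) ->
  wtr h X = wtr m (gl g n * X).
Proof.
move=> gd hm; elim: n X => [|n IHn] X /=; first by rewrite mul1r.
apply: eq_bigr => i _; rewrite mxE (bigD1 i) //= big1 => [|j nji].
  by rewrite addr0 mxE -mulrA wtr_injl -IHn hm mulrA.
by rewrite mxE gd 1?eq_sym // rmorph0 !mul0r.
Qed.

End Traces.

(** * Closing all strands but the first *)

Section Closing.
Variables (F : fieldType) (t0 t1 : F).
Hypotheses (t00 : t0 != 0) (t10 : t1 != 0).
Local Notation alg := (@alg F).

Let a : 'M[F]_4 := mx1 aV.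
Let b : 'M[F]_4 := mx1 bV.
Let s : 'M[F]_4 := mx1 (sV t0 t1).
Let k : 'M[F]_4 := mx1 kV.
Let K : 'M[F]_4 := mx1 (KV t0 t1).
Let l : 'M[F]_4 := mx1 (lV t1).

(* The trace weighted by [hmid] is cyclic for both [aV] and [sV]; multiplying it
   by [kV] gives the Links--Gould weights and multiplying it by [KV] those of [V]. *)
Definition hmid (i : nat) : F :=
  match i with 1 => - t0^-1 | 2 => - t0^-1 | 3 => t1 | 4 => t1 | _ => 0 end.

(* The Links--Gould weights in the basis ordering of [V]. *)
Definition hT (i : nat) : F :=
  match i with 1 => - t0^-1 | 2 => t0^-1 | 3 => t1 | 4 => - t1 | _ => 0 end.

Lemma aV_sq : a * a = 0.
Proof.
by apply/matrixP=> -[[|[|[|[|?]]]] ?] [[|[|[|[|?]]]] ?]; rewrite !mxE !big_ord_recl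
  big_ord0 !mxE /= ?(mul0r, mulr0, addr0).
Qed.
Lemma sV_sq : s * s = 0.
Proof.
by apply/matrixP=> -[[|[|[|[|?]]]] ?] [[|[|[|[|?]]]] ?]; rewrite !mxE !big_ord_recl
  big_ord0 !mxE /= ?(mul0r, mulr0, addr0).
Qed.

Lemma sV_KV : s * K = - (K * s).
Proof. by rewrite /s /K -!mx1M; apply: mx1_add0; check_table; ring. Qed.

Lemma kV_sV : k * s = - (s * k).
Proof. by rewrite /s /k -!mx1M; apply: mx1_add0; check_table; ring. Qed.

Lemma aV_KV : a * K = - (K * a).
Proof. by rewrite /a /K -!mx1M; apply: mx1_add0; check_table; ring. Qed.

Lemma kV_KV : k * K = K * k.
Proof. by rewrite /k /K -!mx1M; apply: eq_mx1; check_table; ring. Qed.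

Lemma aV_sV_bracket : a * s - s * a = k - K.
Proof.
apply/eqP; rewrite subr_eq addrAC -subr_eq opprK /a /s /k /K -!mx1M -!mx1D.
by apply/eqP/eq_mx1; check_table; ring.
Qed.

Local Notation An := (prim a k 1).
Local Notation Sn := (prim s 1 K).

Lemma gl_kV_prim n : gl k n * Sn n = - (Sn n * gl k n).
Proof.
elim: n => [|n IHn] /=; first by rewrite mulr0 mul0r oppr0.
by rewrite gl1 mulrDr mulrDl !tensM mulr1 mul1r kV_sV kV_KV IHn tensNl tensNr opprD.
Qed.

(** The mixed terms cancel because [a] anticommutes with [K] and [gl k] with [Sn]; the others
    telescope as [(k - K) (x) gl k + K (x) (gl k - gl K)]. *)
Lemma prim_bracket n : An n * Sn n - Sn n * An n = gl k n - gl K n.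
Proof.
elim: n => [|n IHn] /=; first by rewrite !mulr0 subrr subrr.
rewrite gl1 !mulrDr !mulrDl !tensM !mulr1 !mul1r aV_KV gl_kV_prim tensNl tensNr opprK.
rewrite addr_cancel_cross -tensNl -tensDl aV_sV_bracket -tensNr -tensDr IHn.
by rewrite tensDl tensDr tensNl !tensNr addrA addrNK.
Qed.

Lemma weight_a : weight hmid 1 a.
Proof.
by move=> [[|[|[|[|?]]]] ?] [[|[|[|[|?]]]] ?] //; rewrite !mxE ?eqxx //= mul1r.
Qed.
Lemma weight_s : weight hmid 1 s.
Proof.
by move=> [[|[|[|[|?]]]] ?] [[|[|[|[|?]]]] ?] //; rewrite !mxE ?eqxx //= mul1r.
Qed.
Section Blocks.
Variables (A : centralAlg F) (y : A) (X : 'M[A]_4).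

Lemma mul_aE i : [/\ (tens a y * X) 0 i = 0, (tens a y * X) 1 i = y * X 0 i,
  (tens a y * X) 2 i = 0 & (tens a y * X) 3 i = y * X 2 i].
Proof.
by split; rewrite mxE !big_ord_recl big_ord0 !mxE /= ?rmorph0 ?rmorph1 !mul0r
  ?mul1r ?add0r ?addr0 //; congr (_ * X _ _); apply: val_inj.
Qed.

Lemma mulaE i : [/\ (X * tens a y) i 0 = X i 1 * y, (X * tens a y) i 1 = 0,
  (X * tens a y) i 2 = X i 3 * y & (X * tens a y) i 3 = 0].
Proof.
by split; rewrite mxE !big_ord_recl big_ord0 !mxE /= ?rmorph0 ?rmorph1 !mul0r
  ?mul1r ?mulr0 ?add0r ?addr0 //; congr (X _ _ * _); apply: val_inj.
Qed.
End Blocks.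

Lemma hT_mid n (Y : alg n) : wtr hT Y = wtr hmid (gl k n * Y).
Proof.
by apply: wtr_gl => [[[|[|[|[|?]]]] ?] [[|[|[|[|?]]]] ?]|[[|[|[|[|?]]]] ?]] //;
  rewrite !mxE //= ?mulr1 ?mulrN1 ?opprK.
Qed.

Lemma hV_mid n (Y : alg n) : wtr (@hV F) Y = wtr hmid (gl K n * Y).
Proof.
by apply: wtr_gl => [[[|[|[|[|?]]]] ?] [[|[|[|[|?]]]] ?]|[[|[|[|[|?]]]] ?]] //;
  rewrite !mxE //=; field.
Qed.

Lemma mid_A n : skew_cyclic hmid 1 (An n).
Proof. by apply: skew_cyclic_prim; [exact: weight_a|exact: weight_diag|exact: weight_1]. Qed.
Lemma mid_S n : skew_cyclic hmid 1 (Sn n).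
Proof. by apply: skew_cyclic_prim; [exact: weight_s|exact: weight_1|exact: weight_diag]. Qed.
Lemma mid_k n : skew_cyclic hmid 1 (gl k n).
Proof. by apply: skew_cyclic_gl; exact: weight_diag. Qed.

(** In the [hmid] trace the two weights differ by [gl k n - gl K n], the bracket of [An] and [Sn].
    Cyclicity turns the bracket term into the trace of [Sn] times the commutator of [Y] and [An],
    and the hypothesis evaluates this as minus the trace of [Sn Z gl k]. As [gl k] anticommutes with
    [Sn], it cancels the correction [Z Sn]. *)
Lemma close_even n (Y Z : alg n) :
  Y * An n + Z * gl k n = An n * Y -> wtr hT (Y - Z * Sn n) = wtr (@hV F) Y.
Proof.
move=> E; rewrite hT_mid hV_mid mulrBr wtrB; apply/eqP; rewrite -subr_eq0 addrAC.
rewrite -wtrB -mulrBl -prim_bracket mulrBl wtrB -[An n * _ * _]mulrA mid_A mul1r.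
rewrite -!mulrA -E mulrDr wtrD opprD addrA mulrA subrr add0r.
rewrite [Sn n * _]mulrA -[wtr _ (Sn n * Z * _)]mul1r -mid_k.
rewrite [gl k n * (_ * _)]mulrA gl_kV_prim mulNr wtrN opprK -mulrA mid_S mul1r.
by rewrite mulrA subrr.
Qed.

(** Same computation as for [close_even], with the correction on the other side. *)
Lemma close_odd n (Y Z : alg n) :
  Y * An n = gl k n * Z + An n * Y -> wtr hT (Y + Sn n * Z) = wtr (@hV F) Y.
Proof.
move=> E; rewrite hT_mid hV_mid mulrDr wtrD; apply/eqP; rewrite -subr_eq0 addrAC.
rewrite -wtrB -mulrBl -prim_bracket mulrBl wtrB -[An n * _ * _]mulrA mid_A mul1r.
rewrite -[_ * Y * _]mulrA E mulrDr wtrD -[_ * An n * _]mulrA addrK !mulrA gl_kV_prim.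
by rewrite mulNr wtrN subrr.
Qed.

Lemma close_trace n (X : alg n.+1) :
  GRing.comm X (prim a k 1 n.+1) ->
  forall i : 'I_4, wtr hT ((twist1 a s K n * X * untwist1 a s K n : 'M[alg n]_4) i i)
    = wtr (@hV F) ((X : 'M[alg n]_4) i i).
Proof.
move=> cX i.
have E j j' : ((X : 'M[alg n]_4) * (tens a (gl k n) + tens 1 (An n))) j j' =
              ((tens a (gl k n) + tens 1 (An n)) * (X : 'M[alg n]_4)) j j'.
  by move: cX; rewrite /GRing.comm /= => ->.
have {}E j j' : (X * tens a (gl k n)) j j' + (X : 'M[alg n]_4) j j' * An n =
   (tens a (gl k n) * X) j j' + An n * (X : 'M[alg n]_4) j j'.
  by have := E j j'; rewrite mulrDr mulrDl [LHS]mxE [RHS]mxE mul_tens1E tens1_mulE.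
have T j : (twist1 a s K n * X * untwist1 a s K n : 'M[alg n]_4) j j =
   (X : 'M[alg n]_4) j j + (tens a (Sn n) * X) j j
   - (X * tens a (Sn n)) j j - (tens a (Sn n) * X * tens a (Sn n)) j j.
  by rewrite /twist1 /untwist1 mulrBr mulr1 !mulrDl mul1r opprD !addrA !entryD !entryN.
rewrite T.
have [a0 a1 a2 a3] := mul_aE (gl k n) X i; have [b0 b1 b2 b3] := mulaE (gl k n) X i.
have [c0 c1 c2 c3] := mul_aE (Sn n) X i; have [d0 d1 d2 d3] := mulaE (Sn n) X i.
have [e0 e1 e2 e3] := mulaE (Sn n) (tens a (Sn n) * X) i.
have {E} := E i i.
have : [\/ i = 0, i = 1, i = 2 | i = 3].
  by case: i {a0 a1 a2 a3 b0 b1 b2 b3 c0 c1 c2 c3 d0 d1 d2 d3 e0 e1 e2 e3} =>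
    [[|[|[|[|?]]]] Hi] //; [apply: Or41|apply: Or42|apply: Or43|apply: Or44];
    apply: val_inj.
(* [aV] sends v1 to v2 and v3 to v4. So at indices 0 and 2 only [X (a (x) S)] meets the diagonal, at
   1 and 3 only [(a (x) S) X], and the two-sided product never does. *)
case=> Ei; subst i.
- have [f0 _ _ _] := mul_aE (Sn n) X 1.
  rewrite a0 b0 add0r c0 d0 e0 f0 mul0r subr0 addr0 addrC; exact: close_even.
- rewrite a1 b1 add0r c1 d1 e1 !subr0; exact: close_odd.
- have [_ _ f2 _] := mul_aE (Sn n) X 3.
  rewrite a2 b2 add0r c2 d2 e2 f2 mul0r subr0 addr0 addrC; exact: close_even.
- rewrite a3 b3 add0r c3 d3 e3 !subr0; exact: close_odd.
Qed.

Local Notation hVF := (@hV F).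

Lemma weightV_a : weight hVF (-1) a.
Proof.
by move=> [[|[|[|[|?]]]] ?] [[|[|[|[|?]]]] ?] //; rewrite !mxE ?eqxx //= ?mulrNN mulr1.
Qed.
Lemma weightV_b : weight hVF (-1) b.
Proof.
by move=> [[|[|[|[|?]]]] ?] [[|[|[|[|?]]]] ?] //; rewrite !mxE ?eqxx //= ?mulrNN mulr1.
Qed.

(** Compare the [(i, j)] blocks of the commutation relation: the [x] terms give the blocks [X i i]
    and [X j j], and the [g] terms have equal traces since the sign of [g i i = - g j j] compensates
    that of moving [Y] around the trace. *)
Lemma skew_block n (x g : 'M[F]_4) (X : alg n.+1) (Y : alg n) i j :
  (forall p, p != j -> x i p = 0) -> (forall p, p != i -> x p j = 0) ->
  x i j = 1 -> is_diag_mx g -> g i i = - g j j ->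
  skew_cyclic hVF (-1) Y -> GRing.comm X (tens x 1 + tens g Y : alg n.+1) ->
  wtr hVF ((X : 'M[alg n]_4) i i) = wtr hVF ((X : 'M[alg n]_4) j j).
Proof.
move=> xi xj x1 /is_diag_mxP gd gij cY cX.
have: ((X : 'M[alg n]_4) * (tens x 1 + tens g Y)) i j = ((tens x 1 + tens g Y) * (X : 'M[alg n]_4)) i j.
  by move: cX; rewrite /GRing.comm /= => ->.
rewrite mulrDr mulrDl !entryD.
have -> : ((X : 'M[alg n]_4) * tens x 1) i j = (X : 'M[alg n]_4) i i.
  rewrite mxE (bigD1 i) //= big1 ?addr0 => [|p /xj E]; rewrite mxE.
    by rewrite x1 rmorph1 !mulr1.
  by rewrite E rmorph0 mul0r mulr0.
have -> : (tens x 1 * (X : 'M[alg n]_4)) i j = (X : 'M[alg n]_4) j j.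
  rewrite mxE (bigD1 j) //= big1 ?addr0 => [|p /xi E]; rewrite mxE.
    by rewrite x1 rmorph1 !mul1r.
  by rewrite E rmorph0 !mul0r.
have -> : ((X : 'M[alg n]_4) * tens g Y) i j = inj (alg n) (g j j) * ((X : 'M[alg n]_4) i j * Y).
  rewrite mxE (bigD1 j) //= big1 ?addr0 => [|p npj]; rewrite mxE.
    by rewrite mulrA -injC mulrA.
  by rewrite gd // rmorph0 mul0r mulr0.
have -> : (tens g Y * (X : 'M[alg n]_4)) i j = inj (alg n) (g i i) * (Y * (X : 'M[alg n]_4) i j).
  rewrite mxE (bigD1 i) //= big1 ?addr0 => [|p npj]; rewrite mxE.
    by rewrite mulrA.
  by rewrite gd 1?eq_sym // rmorph0 !mul0r.
move=> /(congr1 (@wtr _ hVF n)); rewrite !wtrD !wtr_injl cY gij mulN1r mulrNN.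
exact: addIr.
Qed.

Lemma diag1_is_diag (x1 x2 x3 x4 : F) : is_diag_mx (mx1 (diag1 x1 x2 x3 x4)).
Proof.
by apply/is_diag_mxP => -[[|[|[|[|?]]]] ?] [[|[|[|[|?]]]] ?] //; rewrite mxE.
Qed.

(** [a] joins index 0 to 1 and 2 to 3, and [b] joins 2 to 0. Their nonzero entries are 1, so nothing
    is divided by [t0 - 1] or [t1 - 1], which may vanish. *)
Lemma scalar_trace n (X : alg n.+1) :
  GRing.comm X (prim a 1 k n.+1) -> GRing.comm X (prim b 1 l n.+1) ->
  forall i : 'I_4, wtr hVF ((X : 'M[alg n]_4) i i) = wtr hVF ((X : 'M[alg n]_4) 0 0).
Proof.
rewrite /= gl1 => ca cb i.
have cycA : skew_cyclic hVF (-1) (prim a 1 k n).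
  by apply: skew_cyclic_prim; [exact: weightV_a|exact: weight_1|exact: weight_diag].
have cycB : skew_cyclic hVF (-1) (prim b 1 l n).
  by apply: skew_cyclic_prim; [exact: weightV_b|exact: weight_1|exact: weight_diag].
have E10 : wtr hVF ((X : 'M[alg n]_4) 1 1) = wtr hVF ((X : 'M[alg n]_4) 0 0).
  apply: (skew_block _ _ _ _ _ cycA ca); rewrite ?diag1_is_diag ?mxE //;
    by move=> [[|[|[|[|?]]]] ?] //; rewrite mxE.
have E32 : wtr hVF ((X : 'M[alg n]_4) 3 3) = wtr hVF ((X : 'M[alg n]_4) 2 2).
  apply: (skew_block _ _ _ _ _ cycA ca); rewrite ?diag1_is_diag ?mxE //;
    by move=> [[|[|[|[|?]]]] ?] //; rewrite mxE.
have E02 : wtr hVF ((X : 'M[alg n]_4) 0 0) = wtr hVF ((X : 'M[alg n]_4) 2 2).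
  apply: (skew_block _ _ _ _ _ cycB cb); rewrite ?diag1_is_diag ?mxE /= ?opprK //;
    by move=> [[|[|[|[|?]]]] ?] //; rewrite mxE.
have : [\/ i = 0, i = 1, i = 2 | i = 3].
  by case: i => [[|[|[|[|?]]]] Hi] //;
    [apply: Or41|apply: Or42|apply: Or43|apply: Or44]; apply: val_inj.
by case=> ->; rewrite ?E10 ?E32 ?E02.
Qed.
End Closing.

(** * Kernels of operators *)

Section Kernels.
Variable F : fieldType.
Local Notation alg := (@alg F).
Implicit Types (w z : seq 'I_4) (c : 'M['M[F]_4]_4).

(** Words are plain sequences so that letters can be peeled off without length bookkeeping; the
    default [ord0] is reached only by words that are too short. *)
Fixpoint kern n : alg n -> seq 'I_4 -> seq 'I_4 -> F :=
  match n return alg n -> seq 'I_4 -> seq 'I_4 -> F with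
  | 0 => fun X _ _ => X
  | m.+1 => fun X w' w =>
      kern (X (head ord0 w') (head ord0 w) : alg m) (behead w') (behead w)
  end.

Lemma kernD n (X Y : alg n) w' w : kern (X + Y) w' w = kern X w' w + kern Y w' w.
Proof. by elim: n X Y w' w => //= n IHn X Y w' w; rewrite mxE IHn. Qed.

Lemma kern0 n w' w : kern (0 : alg n) w' w = 0.
Proof. by elim: n w' w => //= n IHn w' w; rewrite mxE IHn. Qed.

Lemma kern_sum n I (r : seq I) (X : I -> alg n) w' w :
  kern (\sum_(i <- r) X i) w' w = \sum_(i <- r) kern (X i) w' w.
Proof.
apply: (big_morph (fun X => kern X w' w)); first by move=> X1 X2; exact: kernD.
exact: kern0.
Qed.

Lemma kern_injl n y (X : alg n) w' w : kern (inj (alg n) y * X) w' w = y * kern X w' w.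
Proof.
elim: n X w' w => [|n IHn] //= X w' w; rewrite -IHn.
by rewrite -[_%:M]/(inj (mxAlg (alg n)) y) inj_mxAlgE tens1_mulE.
Qed.

Lemma kern_tens n x (Y : alg n) i j z' z :
  kern (tens x Y : alg n.+1) (i :: z') (j :: z) = x i j * kern Y z' z.
Proof. by rewrite /= mxE kern_injl. Qed.

Lemma kern_inj n y (w' w : state n) :
  kern (inj (alg n) y) w' w = y * (w' == w)%:R.
Proof.
elim: n w' w => [|n IHn] w' w; first by rewrite /= [w']tuple0 [w]tuple0 eqxx mulr1.
case/tupleP: w' => i z'; case/tupleP: w => j z.
rewrite inj_mxAlgE kern_tens IHn mulrCA mxE; congr (_ * _).
rewrite -natrM mulnb; congr (_%:R).
Qed.

Lemma kern1 n (w' w : state n) : kern (1 : alg n) w' w = (w' == w)%:R.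
Proof. by rewrite -(rmorph1 (inj (alg n))) kern_inj mul1r. Qed.

Lemma big_state n (f : state n.+1 -> F) :
  \sum_(w : state n.+1) f w = \sum_(i < 4) \sum_(z : state n) f [tuple of i :: z].
Proof.
rewrite pair_bigA /=.
rewrite (reindex (fun p : 'I_4 * state n => [tuple of p.1 :: p.2])) //=.
exists (fun w : state n.+1 => (thead w, [tuple of behead w])) => [[i z]|w] _ /=.
  by congr pair; apply: val_inj.
by rewrite [RHS]tuple_eta; apply: val_inj.
Qed.

Lemma kernM n (X Y : alg n) w' w :
  kern (X * Y) w' w = \sum_(u : state n) kern X w' u * kern Y u w.
Proof.
elim: n X Y w' w => [|n IHn] X Y w' w /=.
  by rewrite (big_pred1 [tuple]) // => u; apply/esym/eqP/tuple0.
rewrite big_state mxE kern_sum; apply: eq_bigr => i _; exact: IHn.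
Qed.

Lemma wtr_kern h n (X : alg n) :
  wtr h X = \sum_(z : state n) (\prod_(q < n) h (letter z q).+1) * kern X z z.
Proof.
elim: n X => [|n IHn] X /=.
  rewrite (big_pred1 [tuple]) => [|u]; first by rewrite big_ord0 mul1r.
  exact/esym/eqP/tuple0.
rewrite big_state; apply: eq_bigr => i _; rewrite IHn mulr_sumr.
by apply: eq_bigr => z _; rewrite big_ord_recl /= !mulrA.
Qed.

(** The first strand carries no weight, so each value of its letter contributes the weighted trace
    of one diagonal block. *)
Lemma closed_trace h n (X : alg n.+1) :
  \sum_(w : state n.+1)
    (\prod_(q < n.+1 | (0 < (q : nat))%N) h (letter w q).+1) * kern X w w
  = \sum_(i < 4) wtr h ((X : 'M[alg n]_4) i i).
Proof.
rewrite big_state; apply: eq_bigr => i _; rewrite wtr_kern.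
by apply: eq_bigr => z _; rewrite big_mkcond big_ord_recl /= mul1r.
Qed.

Lemma kern_gen0 c n (z' z : state n) k l i j :
  kern (gen c n.+2 0) (k :: l :: z') (i :: j :: z) = c k i l j * (z' == z)%:R.
Proof. by rewrite /= !mxE kern_inj. Qed.

Lemma kern_genS c n p (z' z : state n) k i :
  kern (gen c n.+1 p.+1) (k :: z') (i :: z) = (k == i)%:R * kern (gen c n p) z' z.
Proof. by rewrite [gen _ _ _]/= kern_tens mxE. Qed.

Definition mx2o (f : 'I_4 -> 'I_4 -> 'I_4 -> 'I_4 -> F) : 'M['M[F]_4]_4 :=
  \matrix_(k, i) \matrix_(l, j) f i j k l.

Lemma genopE cf n p eps (w' w : state n) : (p.+1 < n)%N ->
  genop cf (p, eps) w' w = kern (gen (mx2o (Rcoef cf eps)) n p) w' w.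
Proof.
elim: n p w' w => // n IHn p w' w.
case/tupleP: w' => k z'; case/tupleP: w => i z.
case: p => [|p].
  case: n {IHn} z' z => // n z' z _.
  case/tupleP: z' => l z'; case/tupleP: z => j z.
  rewrite kern_gen0 /genop /= !mxE /letter /= mulrC; congr (_ * (nat_of_bool _)%:R).
  apply/forallP/eqP => [E|-> q]; last first.
    by apply/implyP; case: q => [[|[|q]] Hq].
  apply/val_inj/(@eq_from_nth _ ord0); rewrite ?size_tuple // => q Hq.
  by have := E (Ordinal (Hq : (q.+2 < n.+2)%N)) => /= /eqP.
rewrite ltnS => lt_p; rewrite kern_genS -IHn // /genop /= mulrA; congr (_ * _).
rewrite -natrM mulnb; congr ((nat_of_bool _)%:R).
apply/forallP/andP => [E|[/eqP -> /forallP E] q].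
  split; first by have /= := E ord0.
  by apply/forallP => q; exact: (E (lift ord0 q)).
case: q => [[|q] Hq] /=; first by rewrite eqxx.
exact: (E (Ordinal (Hq : (q < n)%N))).
Qed.

Definition word n (cs : bool -> 'M['M[F]_4]_4) (b : seq (nat * bool)) : alg n :=
  foldr (fun g X => gen (cs g.2) n g.1 * X) 1 b.

Lemma braidopE cf n b (w' w : state n) : braid_word n b ->
  braidop cf b w' w = kern (word n (fun eps => mx2o (Rcoef cf eps)) b) w' w.
Proof.
elim: b w' w => [|[p eps] b IHb] w' w /=; first by rewrite /idop kern1.
case/andP=> lt_p wb; rewrite kernM; apply: eq_bigr => u _.
by rewrite -genopE // IHb.
Qed.

Lemma invariantE cf h n b : braid_word n.+1 b ->
  @Defs.invariant F n.+1 cf h b = (4%:R)^-1 *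
   \sum_(i < 4) wtr h ((word n.+1 (fun eps => mx2o (Rcoef cf eps)) b : 'M[alg n]_4) i i).
Proof.
move=> wb; rewrite /Defs.invariant -closed_trace; congr (_ * _); apply: eq_bigr => w _.
by rewrite braidopE.
Qed.

Lemma sum16 (G : nat -> nat -> F) :
  \sum_(x < 16) G (x %/ 4)%N (x %% 4)%N = \sum_(p < 4) \sum_(q < 4) G p q.
Proof. by rewrite !big_ord_recl !big_ord0 /= !addr0 !addrA. Qed.

(** A right inverse of a square matrix over a field is the inverse, so one table product identifies
    [invmx]. Pairs of letters are decoded from [4 * k + l] by division with remainder. *)
Lemma Rcoef_inv cf (T Ti : tab2 F) :
  (forall i j k l : 'I_4, cf i.+1 j.+1 k.+1 l.+1 = odflt 0 (T i.+1 j.+1 k.+1 l.+1)) ->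
  eqt2 (mul2 T Ti) (kron id1 id1) ->
  mx2o (Rcoef cf false) = mx2 Ti.
Proof.
move=> cfE TTi; pose ci i j k l := odflt 0 (Ti i j k l).
have div4 (x : 'I_16) : (x %/ 4 < 4)%N by rewrite ltn_divLR.
have mod4 (x : 'I_16) : (x %% 4 < 4)%N by rewrite ltn_pmod.
have E : Rmx cf *m Rmx ci = 1%:M.
  apply/matrixP=> x y; rewrite !mxE.
  under eq_bigr => z _ do rewrite !mxE.
  rewrite (sum16 (fun p q => cf p.+1 q.+1 (x %/ 4).+1 (x %% 4).+1 *
                             ci (y %/ 4).+1 (y %% 4).+1 p.+1 q.+1)).
  have := eq_mx2 TTi; rewrite mx2_kron mx1_1 kr11.
  move=> /matrixP/(_ (Ordinal (div4 x)) (Ordinal (div4 y))).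
  rewrite [LHS]mxE [RHS]mxE.
  move=> /matrixP/(_ (Ordinal (mod4 x)) (Ordinal (mod4 y))).
  rewrite !mxE odflt_sum4 /=; under eq_bigr => p _ do rewrite odflt_sum4.
  move=> E1.
  transitivity (\sum_(p < 4) \sum_(q < 4) odflt 0
     (omul (T p.+1 q.+1 (x %/ 4).+1 (x %% 4).+1) (Ti (y %/ 4).+1 (y %% 4).+1 p.+1 q.+1))).
    apply: eq_bigr => p _; apply: eq_bigr => q _; rewrite odflt_mul.
    by rewrite -(cfE p q (Ordinal (div4 x)) (Ordinal (mod4 x))).
  rewrite E1 -val_eqE /=.
  have -> : (x == y) = (x %/ 4 == y %/ 4)%N && (x %% 4 == y %% 4)%N.
    by rewrite -val_eqE /=; lia.
  by case: (_ == _ :> nat); rewrite !mxE -?val_eqE.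
have Ei : invmx (Rmx cf) = Rmx ci.
  have [u _] := mulmx1_unit E.
  by rewrite -[RHS]mul1mx -(mulVmx u) -mulmxA E mulmx1.
apply/matrixP=> k i; rewrite !mxE; apply/matrixP=> l j; rewrite !mxE /Rcoef Ei mxE.
have dm (p q : 'I_4) : (4 * p + q < 16)%N by case: p q => p ? [q ?] /=; lia.
by rewrite !inordK // ![(4 * _)%N]mulnC !divnMDl // !modnMDl !divn_small // !addn0 !modn_small.
Qed.

End Kernels.

(** * Comparison of kernels *)

Section Rescaling.
Variables (F : fieldType) (u d u' d' : F).
Hypothesis udE : u * d = u' * d'.
Local Notation alg := (@alg F).

Definition wt4 (i : nat) : nat := match i with 4 => 1%N | _ => 0%N end.
Definition num4 (w : seq 'I_4) : nat := sumn [seq wt4 i.+1 | i : 'I_4 <- w].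

(* [x] and [y] are the same multiple of [u ^ (e' - e)] and [u' ^ (e' - e)],
   negative powers of [u] being read as positive powers of [d]. *)
Definition linked (e' e : nat) (x y : F) :=
  exists B, x = u ^+ (e' - e) * d ^+ (e - e') * B /\
            y = u' ^+ (e' - e) * d' ^+ (e - e') * B.

Lemma linked0 e' e : linked e' e 0 0.
Proof. by exists 0; rewrite !mulr0. Qed.

Lemma linked_refl e x : linked e e x x.
Proof. by exists x; rewrite subnn !expr0 !mul1r. Qed.

Lemma linked_eq e x y : linked e e x y -> x = y.
Proof. by case=> B []; rewrite subnn !expr0 !mul1r => -> ->. Qed.

Lemma linkedD e' e x y x' y' :
  linked e' e x y -> linked e' e x' y' -> linked e' e (x + x') (y + y').
Proof. by case=> B [-> ->] [B' [-> ->]]; exists (B + B'); rewrite !mulrDr. Qed.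

Lemma linked_scale e' e z x y : linked e' e x y -> linked e' e (z * x) (z * y).
Proof. by case=> B [-> ->]; exists (z * B); rewrite !(mulrCA z). Qed.

Lemma linked_shift m e' e x y : linked e' e x y -> linked (m + e') (m + e) x y.
Proof. by case=> B [-> ->]; exists B; rewrite !subnDl. Qed.

(** When a factor raises the exponent and the other lowers it, the surplus consists of pairs
    [u * d], equal to pairs [u' * d'] by [udE]. *)
Lemma linkedM e'' e' e x y x' y' :
  linked e'' e' x y -> linked e' e x' y' -> linked e'' e (x * x') (y * y').
Proof.
case=> B [-> ->] [B' [-> ->]].
(* The number of cancelling pairs; all subtractions are truncated, so a rise and a fall are counted
   separately. *)
pose k := ((e'' - e') + (e' - e) - (e'' - e))%N.
have E1 : ((e'' - e') + (e' - e) = (e'' - e) + k)%N by rewrite /k; lia.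
have E2 : ((e' - e'') + (e - e') = (e - e'') + k)%N by rewrite /k; lia.
have E v v' : v ^+ (e'' - e') * v' ^+ (e' - e'') * B *
    (v ^+ (e' - e) * v' ^+ (e - e') * B') =
    v ^+ (e'' - e) * v' ^+ (e - e'') * ((v * v') ^+ k * B * B').
  transitivity (v ^+ ((e'' - e') + (e' - e)) * v' ^+ ((e' - e'') + (e - e')) * (B * B')).
    by rewrite !exprD; ring.
  by rewrite E1 E2 !exprD exprMn; ring.
by exists ((u * d) ^+ k * B * B'); rewrite !E udE.
Qed.

Lemma linked_gen (T T' : tab2 F) n p (w' w : state n) : (p.+1 < n)%N ->
  (forall i j k l : 'I_4, linked (wt4 k.+1 + wt4 l.+1) (wt4 i.+1 + wt4 j.+1)
     (odflt 0 (T i.+1 j.+1 k.+1 l.+1)) (odflt 0 (T' i.+1 j.+1 k.+1 l.+1))) ->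
  linked (num4 w') (num4 w) (kern (gen (mx2 T) n p) w' w) (kern (gen (mx2 T') n p) w' w).
Proof.
move=> + TT; elim: n p w' w => // n IHn p w' w.
case/tupleP: w' => k z'; case/tupleP: w => i z.
case: p => [|p].
  case: n {IHn} z' z => // n z' z _.
  case/tupleP: z' => l z'; case/tupleP: z => j z.
  rewrite !kern_gen0 !mxE; have [->|_] := eqVneq z' z; last by rewrite !mulr0; exact: linked0.
  rewrite !mulr1 /num4 /= !addnA ![(_ + sumn _)%N]addnC.
  exact/linked_shift/TT.
rewrite ltnS => lt_p; rewrite !kern_genS.
have [->|_] := eqVneq k i; last by rewrite !mul0r; exact: linked0.
by apply/linked_scale/linked_shift/IHn.
Qed.

(** On the diagonal the rises and falls of [num4] balance, so traces depend on [u] and [d] only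
    through [u * d]. This changes the pair without conjugating by powers of [Y], which may be 0. *)
Lemma linked_word (T T' : bool -> tab2 F) n b (w' w : state n) : braid_word n b ->
  (forall e, forall i j k l : 'I_4, linked (wt4 k.+1 + wt4 l.+1) (wt4 i.+1 + wt4 j.+1)
     (odflt 0 (T e i.+1 j.+1 k.+1 l.+1)) (odflt 0 (T' e i.+1 j.+1 k.+1 l.+1))) ->
  linked (num4 w') (num4 w) (kern (word n (fun e => mx2 (T e)) b) w' w)
                            (kern (word n (fun e => mx2 (T' e)) b) w' w).
Proof.
move=> + TT; elim: b w' w => [|[p e] b IHb] w' w /=.
  by rewrite !kern1; have [->|_] := eqVneq w' w; [move=> _; exact: linked_refl | move=> _; exact: linked0].
case/andP=> lt_p wb; rewrite !kernM.
apply: (big_ind2 (linked (num4 w') (num4 w))); first exact: linked0.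
  by move=> *; exact: linkedD.
by move=> v _; apply: (@linkedM _ (num4 v)); [exact: linked_gen | exact: IHb].
Qed.

End Rescaling.

(** * Relabelling of the basis and the bicharacter twist *)

Section Gauge.
Variables (F : fieldType) (s0 s1 : F).
Hypotheses (s00 : s0 != 0) (s10 : s1 != 0).
Local Notation alg := (@alg F).

Definition sigma (i : 'I_4) : 'I_4 := inord (sgm i.+1).-1.

Lemma sigmaE i : (sigma i).+1 = sgm i.+1.
Proof. by case: i => [[|[|[|[|?]]]] ?] //; rewrite /sigma inordK. Qed.

Lemma sigma_inj : injective sigma.
Proof.
move=> i j /(congr1 (fun x : 'I_4 => x.+1)); rewrite !sigmaE => E.
by apply: val_inj; case: i j E => [[|[|[|[|?]]]] ?] [[|[|[|[|?]]]] ?].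
Qed.

Definition sigmas n (w : state n) : state n := map_tuple sigma w.

Lemma sigmas_bij n : bijective (@sigmas n).
Proof.
apply: injF_bij => w w' /(congr1 val) /= /(inj_map sigma_inj) E.
exact: val_inj.
Qed.

Definition chiV (i j : 'I_4) : F := chi s0 s1 (sgm i.+1) (sgm j.+1).

(** The product of [chiV] over all pairs of positions in increasing order: the diagonal operator
    that performs the bicharacter twist on all strands at once. *)
Fixpoint gauge (w : seq 'I_4) : F :=
  if w is i :: z then gauge z * \prod_(j <- z) chiV i j else 1.

Lemma chiV_neq0 i j : chiV i j != 0.
Proof.
by case: i j => [[|[|[|[|?]]]] ?] [[|[|[|[|?]]]] ?] //;
  rewrite /chiV /= ?oppr_eq0 ?invr_eq0 ?mulf_eq0 ?expf_eq0 /= ?oppr_eq0 ?oner_eq0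
    ?(negPf s00) ?(negPf s10).
Qed.

Lemma gauge_neq0 w : gauge w != 0.
Proof.
elim: w => [|i z IHz] /=; first exact: oner_neq0.
rewrite mulf_neq0 //; elim/big_ind: _ => [|x y|j _]; [exact: oner_neq0| |exact: chiV_neq0].
exact: mulf_neq0.
Qed.

(** Charge conservation, used with [g] one row or one column of the bicharacter. *)
Definition conserves (g : 'I_4 -> F) (T : tab2 F) := forall i j k l : 'I_4,
  odflt 0 (T i.+1 j.+1 k.+1 l.+1) != 0 -> g k * g l = g i * g j.

Lemma kern_conserves g T n p (w' w : state n) : (p.+1 < n)%N -> conserves g T ->
  kern (gen (mx2 T) n p) w' w != 0 -> \prod_(j <- w') g j = \prod_(j <- w) g j.
Proof.
move=> + gT; elim: n p w' w => // n IHn p w' w.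
case/tupleP: w' => k z'; case/tupleP: w => i z.
case: p => [|p].
  case: n {IHn} z' z => // n z' z _.
  case/tupleP: z' => l z'; case/tupleP: z => j z.
  rewrite !kern_gen0 !mxE !big_cons !mulrA; have [->|_] := eqVneq z' z.
    by rewrite mulr1 => /gT ->.
  by rewrite mulr0 eqxx.
rewrite ltnS => lt_p; rewrite !kern_genS !big_cons.
have [->|_] := eqVneq k i; last by rewrite mul0r eqxx.
by rewrite mul1r => /IHn ->.
Qed.

(** The pair of strands at the crossing supplies the ratio of [chi] values in [twist]; pairs meeting
    the crossing in one strand keep their total factor by conservation, and all other pairs are
    unchanged. *)
Lemma gauge_gen T n p (w' w : state n) : (p.+1 < n)%N ->
  (forall i, conserves (chiV i) (twist s0 s1 T)) ->
  (forall i, conserves (chiV^~ i) (twist s0 s1 T)) ->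
  kern (gen (mx2 T) n p) (sigmas w') (sigmas w) * gauge w =
  gauge w' * kern (gen (mx2 (twist s0 s1 T)) n p) w' w.
Proof.
move=> + cl cr; elim: n p w' w => // n IHn p w' w.
case/tupleP: w' => k z'; case/tupleP: w => i z.
case: p => [|p].
  case: n {IHn} z' z => // n z' z _.
  case/tupleP: z' => l z'; case/tupleP: z => j z.
  have -> : kern (gen (mx2 T) n.+2 0) (sigmas [tuple of k :: [tuple of l :: z']])
      (sigmas [tuple of i :: [tuple of j :: z]]) =
      kern (gen (mx2 T) n.+2 0) (sigma k :: sigma l :: sigmas z')
                                (sigma i :: sigma j :: sigmas z) by [].
  rewrite !kern_gen0 !mxE !sigmaE (inj_eq (bij_inj (@sigmas_bij n))).
  have [->|_] := eqVneq z' z; last by rewrite !mulr0 mul0r.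
  rewrite !mulr1 [gauge _]/= [gauge (k :: _)]/= !big_cons.
  have E : odflt 0 (twist s0 s1 T i.+1 j.+1 k.+1 l.+1) * chiV k l =
           odflt 0 (T (sgm i.+1) (sgm j.+1) (sgm k.+1) (sgm l.+1)) * chiV i j.
    rewrite /twist; case: (T _ _ _ _) => [x|] /=; last by rewrite !mul0r.
    by rewrite mulfVK // chiV_neq0.
  have [T0|nz] := eqVneq (odflt 0 (twist s0 s1 T i.+1 j.+1 k.+1 l.+1)) 0.
    have := E; rewrite T0 mul0r => /esym/eqP; rewrite mulf_eq0 (negPf (chiV_neq0 _ _)).
    by rewrite orbF => /eqP ->; rewrite mul0r mulr0.
  have Ez : (\prod_(q <- z) chiV k q) * (\prod_(q <- z) chiV l q) =
            (\prod_(q <- z) chiV i q) * (\prod_(q <- z) chiV j q).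
    rewrite -!big_split; apply: eq_bigr => q _ /=; exact: (cr q _ _ _ _ nz).
  rewrite -[in RHS]mulrA.
  transitivity (gauge z * (odflt 0 (T (sgm i.+1) (sgm j.+1) (sgm k.+1) (sgm l.+1)) * chiV i j)
      * (\prod_(q <- z) chiV i q * \prod_(q <- z) chiV j q)); first by ring.
  by rewrite -E -Ez; ring.
rewrite ltnS => lt_p.
have -> : kern (gen (mx2 T) n.+1 p.+1) (sigmas [tuple of k :: z']) (sigmas [tuple of i :: z])
  = kern (gen (mx2 T) n.+1 p.+1) (sigma k :: sigmas z') (sigma i :: sigmas z) by [].
rewrite !kern_genS (inj_eq sigma_inj); have [->|_] := eqVneq k i; last by rewrite !mul0r mulr0.
rewrite !mul1r [gauge _]/= [gauge (i :: z')]/= mulrA IHn //.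
have [->|nz] := eqVneq (kern (gen (mx2 (twist s0 s1 T)) n p) z' z) 0.
  by rewrite !mulr0 mul0r.
by rewrite (kern_conserves lt_p (cl i) nz) mulrAC.
Qed.

Lemma gauge_word (T : bool -> tab2 F) n b (w' w : state n) : braid_word n b ->
  (forall e i, conserves (chiV i) (twist s0 s1 (T e))) ->
  (forall e i, conserves (chiV^~ i) (twist s0 s1 (T e))) ->
  kern (word n (fun e => mx2 (T e)) b) (sigmas w') (sigmas w) * gauge w =
  gauge w' * kern (word n (fun e => mx2 (twist s0 s1 (T e))) b) w' w.
Proof.
move=> + cl cr; elim: b w' w => [|[p e] b IHb] w' w /=.
  rewrite !kern1 (inj_eq (bij_inj (@sigmas_bij n))) => _.
  by have [->|_] := eqVneq w' w; rewrite ?mulr1 ?mul1r ?mulr0 ?mul0r.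
case/andP=> lt_p wb; rewrite !kernM mulr_suml mulr_sumr.
rewrite (reindex (@sigmas n)); last by apply: onW_bij; exact: sigmas_bij.
apply: eq_bigr => v _ /=.
by rewrite -mulrA IHb // mulrA gauge_gen // mulrA.
Qed.

End Gauge.

(** * The partial trace on the [V] side *)

Section VSide.
Variables (F : fieldType) (t0 t1 : F).
Hypotheses (t00 : t0 != 0) (t10 : t1 != 0).
Local Notation alg := (@alg F).

Definition tV (e : bool) : tab2 F := if e then tRV t0 t1 else tRVi t0 t1.

Lemma comm_tab (c x : tab2 F) : eqt2 (mul2 c x) (mul2 x c) -> GRing.comm (mx2 c) (mx2 x).
Proof. by move=> /eq_mx2; rewrite !mx2M. Qed.

Lemma tV_grouplike e : [/\ GRing.comm (mx2 (tV e)) (kr (mx1 kV) (mx1 kV)),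
  GRing.comm (mx2 (tV e)) (kr (mx1 (KV t0 t1)) (mx1 (KV t0 t1))) &
  GRing.comm (mx2 (tV e)) (kr (mx1 (lV t1)) (mx1 (lV t1)))].
Proof.
by case: e; split; rewrite -!mx2_kron; apply: comm_tab; rewrite /tV; check_table;
  field; rewrite ?t00 ?t10.
Qed.

(** Both coproducts of [aV] occur: [a (x) k + 1 (x) a] serves the cocycle and [close_trace], while
    [a (x) 1 + k (x) a] serves [scalar_trace]. *)
Lemma tV_prim e :
  [/\ GRing.comm (mx2 (tV e)) (kr (mx1 aV) (mx1 kV) + kr 1 (mx1 aV)),
   GRing.comm (mx2 (tV e)) (kr (mx1 (sV t0 t1)) 1 + kr (mx1 (KV t0 t1)) (mx1 (sV t0 t1))),
   GRing.comm (mx2 (tV e)) (kr (mx1 aV) 1 + kr (mx1 kV) (mx1 aV)) &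
   GRing.comm (mx2 (tV e)) (kr (mx1 bV) 1 + kr (mx1 (lV t1)) (mx1 bV))].
Proof.
by case: e; split; rewrite -mx1_1 -!mx2_kron -mx2D; apply: comm_tab; rewrite /tV;
  check_table; field; rewrite ?t00 ?t10.
Qed.

Lemma tV_inv : eqt2 (mul2 (tRV t0 t1) (tRVi t0 t1)) (kron id1 id1).
Proof. by check_table; field; rewrite ?t00 ?t10. Qed.

Lemma word_comm n (cs : bool -> 'M['M[F]_4]_4) b (Z : alg n) :
  (forall e p, GRing.comm (gen (cs e) n p) Z) -> GRing.comm (word n cs b) Z.
Proof.
move=> H; elim: b => [|g b IHb] /=; first exact/commr_sym/commr1.
by apply/commr_sym/commrM; apply/commr_sym.
Qed.

Lemma word_intertwine n (cs cs' : bool -> 'M['M[F]_4]_4) b (P : alg n) :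
  braid_word n b ->
  (forall e p, (p.+1 < n)%N -> P * gen (cs e) n p = gen (cs' e) n p * P) ->
  P * word n cs b = word n cs' b * P.
Proof.
move=> + H; elim: b => [|[p e] b IHb] /=; first by rewrite mulr1 mul1r.
by case/andP=> lt_p wb; rewrite mulrA H // -mulrA IHb // mulrA.
Qed.

Let a : 'M[F]_4 := mx1 aV.
Let s : 'M[F]_4 := mx1 (sV t0 t1).
Let k : 'M[F]_4 := mx1 kV.
Let K : 'M[F]_4 := mx1 (KV t0 t1).

Lemma weightT_a : weight (hT t0 t1) (-1) a.
Proof.
by move=> [[|[|[|[|?]]]] ?] [[|[|[|[|?]]]] ?] //; rewrite !mxE ?eqxx //= mulN1r ?opprK.
Qed.
Lemma weightT_s : weight (hT t0 t1) (-1) s.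
Proof.
by move=> [[|[|[|[|?]]]] ?] [[|[|[|[|?]]]] ?] //; rewrite !mxE ?eqxx //= mulN1r ?opprK.
Qed.

(** For the weights [hT] both [a] and [S] pick up a sign, so [a (x) S] moves around the trace
    freely. *)
Lemma Phi_cyclic n : skew_cyclic (hT t0 t1) 1 (Phi a s K n).
Proof.
elim: n => [|n IHn]; first exact: skew_cyclic1.
rewrite -[Phi _ _ _ _]/(tens 1 (Phi a s K n) * twist1 a s K n).
rewrite -[X in skew_cyclic _ X]mulr1; apply: skew_cyclicM.
  rewrite -[X in skew_cyclic _ X]mulr1; apply: skew_cyclic_tens => //.
  exact: weight_1.
apply: skew_cyclicD; first exact: skew_cyclic1.
rewrite -[X in skew_cyclic _ X]mulr1 -mulrNN; apply: skew_cyclic_tens; first exact: weightT_a.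
by apply: skew_cyclic_prim; [exact: weightT_s|exact: weight_1|exact: weight_diag].
Qed.

Lemma V_trace_eq n b (T : bool -> tab2 F) : braid_word n.+1 b ->
  (forall e, (1 + kr a s) * mx2 (tV e) = mx2 (T e) * (1 + kr a s)) ->
  forall i : 'I_4,
    wtr (hT t0 t1) ((word n.+1 (fun e => mx2 (T e)) b : 'M[alg n]_4) i i) =
    wtr (@hV F) ((word n.+1 (fun e => mx2 (tV e)) b : 'M[alg n]_4) 0 0).
Proof.
move=> wb TE i; set X := word n.+1 (fun e => mx2 (tV e)) b.
have -> : word n.+1 (fun e => mx2 (T e)) b = Phi a s K n.+1 * X * Psi a s K n.+1.
  rewrite (@word_intertwine _ _ (fun e => mx2 (T e))) // => [|e p lt_p].
    by rewrite -mulrA Phi_Psi ?mulr1 //; exact: aV_sq.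
  have [ck cK cl] := tV_grouplike e; have [ca cs _ _] := tV_prim e.
  by apply: (Phi_gen (k := k)); rewrite ?aV_sq ?sV_sq ?sV_KV ?aV_sV_bracket.
(* The outer factors [1 (x) Phi] and [1 (x) Psi] act inside each block, where cyclicity cancels
   them; only the conjugation by [twist1] is left for [close_trace]. *)
have -> : ((Phi a s K n.+1 * X * Psi a s K n.+1 : 'M[alg n]_4) i i) =
   Phi a s K n * ((twist1 a s K n * X * untwist1 a s K n : 'M[alg n]_4) i i * Psi a s K n).
  by rewrite -mul_tens1E -tens1_mulE /= !mulrA.
rewrite Phi_cyclic mul1r -mulrA (Psi_Phi _ _ (aV_sq F)) mulr1 close_trace //; last first.
  apply: word_comm => e p; have [ck cK cl] := tV_grouplike e.
  have [ca cs _ _] := tV_prim e.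
  by apply: gen_prim => //; rewrite kr11; exact: commr1.
rewrite (scalar_trace (t1 := t1)) //; apply: word_comm => e p;
  have [ck cK cl] := tV_grouplike e; have [_ _ ca cb] := tV_prim e;
  by apply: gen_prim => //; rewrite kr11; exact: commr1.
Qed.

Lemma V_trace_scalar n b i :
    wtr (@hV F) ((word n.+1 (fun e => mx2 (tV e)) b : 'M[alg n]_4) i i) =
    wtr (@hV F) ((word n.+1 (fun e => mx2 (tV e)) b : 'M[alg n]_4) 0 0).
Proof.
rewrite (scalar_trace (t1 := t1)) //; apply: word_comm => e p;
  have [ck cK cl] := tV_grouplike e; have [_ _ ca cb] := tV_prim e;
  by apply: gen_prim => //; rewrite kr11; exact: commr1.
Qed.

Lemma RV_tab i j k' l : RV t0 t1 i j k' l = odflt 0 (tRV t0 t1 i j k' l).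
Proof.
case: i => [|[|[|[|[|i]]]]] //; case: j => [|[|[|[|[|j]]]]] //;
case: k' => [|[|[|[|[|k']]]]] //; by case: l => [|[|[|[|[|l]]]]].
Qed.

Lemma RcoefV e : mx2o (Rcoef (RV t0 t1) e) = mx2 (tV e).
Proof.
case: e; last by apply: Rcoef_inv tV_inv => *; exact: RV_tab.
by apply/matrixP=> ? ?; rewrite !mxE; apply/matrixP=> ? ?; rewrite !mxE; exact: RV_tab.
Qed.

(** The factors 4 stay uncancelled because [F] may have characteristic 2. *)
Lemma V1invE n b : braid_word n.+1 b ->
  V1inv t0 t1 n.+1 b = (4%:R)^-1 * (4%:R *
    wtr (@hV F) ((word n.+1 (fun e => mx2 (tV e)) b : 'M[alg n]_4) 0 0)).
Proof.
move=> wb; rewrite /V1inv invariantE //.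
have -> : word n.+1 (fun e => mx2o (Rcoef (RV t0 t1) e)) b = word n.+1 (fun e => mx2 (tV e)) b.
  by elim: b {wb} => //= g b ->; rewrite RcoefV.
under eq_bigr => i _ do rewrite V_trace_scalar.
by rewrite sumr_const card_ord mulr_natl.
Qed.

(** * Integrality: Laurent polynomial values *)

Definition laurent (x : F) := exists p k, x = laurent_eval p k t0 t1.

(** Evaluation as a composite of ring morphisms, convertible to the one inside [laurent_eval]; the
    outer variable is sent to [t0], the inner one to [t1]. *)
Let ev1 : {rmorphism {poly int} -> F} := horner_eval t1 \o map_poly intr.
Let ev : {rmorphism {poly {poly int}} -> F} := horner_eval t0 \o map_poly ev1.

Lemma laurent_evalE p m : laurent_eval p m t0 t1 = ev p / (t0 * t1) ^+ m.
Proof. by []. Qed.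

Lemma evX : ev 'X = t0.
Proof. by rewrite -[ev _]/((map_poly ev1 'X).[t0]) map_polyX hornerX. Qed.

Lemma evXC : ev ('X)%:P = t1.
Proof. rewrite -[ev _]/((map_poly ev1 ('X)%:P).[t0]) map_polyC hornerC.
by rewrite -[LHS]/((map_poly intr 'X).[t1]) map_polyX hornerX.
 Qed.

Lemma t01 m : (t0 * t1) ^+ m != 0.
Proof. by rewrite expf_neq0 // mulf_neq0. Qed.

Lemma laurent_int (m : int) : laurent m%:~R.
Proof. by exists m%:~R, 0%N; rewrite laurent_evalE expr0 divr1 rmorph_int. Qed.

Lemma laurentM x y : laurent x -> laurent y -> laurent (x * y).
Proof.
move=> [p [k' ->]] [q [l ->]]; exists (p * q), (k' + l)%N.
by rewrite !laurent_evalE rmorphM exprD invfM mulrACA.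
Qed.

Lemma laurentD x y : laurent x -> laurent y -> laurent (x + y).
Proof.
move=> [p [k' ->]] [q [l ->]].
exists (p * ('X * ('X)%:P) ^+ l + q * ('X * ('X)%:P) ^+ k'), (k' + l)%N.
rewrite !laurent_evalE rmorphD !rmorphM !rmorphXn !rmorphM evX evXC.
by rewrite addf_div ?t01 // exprD.
Qed.

Lemma laurentN x : laurent x -> laurent (- x).
Proof. by rewrite -mulN1r; apply: laurentM; exact: (laurent_int (-1)). Qed.

Lemma laurent_t0 : laurent t0.
Proof. by exists 'X, 0%N; rewrite laurent_evalE expr0 divr1 evX. Qed.
Lemma laurent_t1 : laurent t1.
Proof. by exists ('X)%:P, 0%N; rewrite laurent_evalE expr0 divr1 evXC. Qed.
(** Only powers of [t0 * t1] are available as denominators, so the inverse is represented as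
    [t1 / (t0 * t1)]. *)
Lemma laurent_t0V : laurent t0^-1.
Proof. by exists ('X)%:P, 1%N; rewrite laurent_evalE expr1 evXC invfM mulrCA divff ?mulr1. Qed.
Lemma laurent_t1V : laurent t1^-1.
Proof. by exists 'X, 1%N; rewrite laurent_evalE expr1 evX invfM mulVKf. Qed.
Lemma laurent_nat (m : nat) : laurent m%:R.
Proof. exact: (laurent_int m). Qed.
Lemma laurent0 : laurent 0. Proof. exact: (laurent_int 0). Qed.
Lemma laurent1 : laurent 1. Proof. exact: (laurent_int 1). Qed.
Lemma laurent2 : laurent 2. Proof. exact: (laurent_int 2). Qed.

(** Integrality is read off on this side, where the entries of R and of its inverse involve neither
    square roots nor [Y]. *)
Lemma laurent_tV e i j k' l : laurent (odflt 0 (tV e i j k' l)).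
Proof.
case: e; case: i => [|[|[|[|[|i]]]]]; try exact: laurent0;
case: j => [|[|[|[|[|j]]]]]; try exact: laurent0;
case: k' => [|[|[|[|[|k']]]]]; try exact: laurent0;
case: l => [|[|[|[|[|l]]]]]; try exact: laurent0;
rewrite /tV /=;
repeat first [exact: laurent_t0 | exact: laurent_t1 | exact: laurent_t0V
  | exact: laurent_t1V | exact: laurent1 | exact: laurent2
  | apply: laurentN | apply: laurentM | apply: laurentD].
Qed.

Lemma laurent_sum (I : finType) (f : I -> F) :
  (forall i, laurent (f i)) -> laurent (\sum_i f i).
Proof. by move=> H; apply: big_ind => // [|x y]; [exact: laurent0|exact: laurentD]. Qed.

Lemma laurent_gen e n p (w' w : state n) : (p.+1 < n)%N ->
  laurent (kern (gen (mx2 (tV e)) n p) w' w).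
Proof.
elim: n p w' w => // n IHn p w' w.
case/tupleP: w' => x z'; case/tupleP: w => i z.
case: p => [|p].
  case: n {IHn} z' z => // n z' z _.
  case/tupleP: z' => l z'; case/tupleP: z => j z.
  rewrite kern_gen0 !mxE; apply: laurentM; first exact: laurent_tV.
  exact: laurent_nat.
rewrite ltnS => lt_p; rewrite kern_genS; apply: laurentM; last exact: IHn.
exact: laurent_nat.
Qed.

Lemma laurent_word n b (w' w : state n) : braid_word n b ->
  laurent (kern (word n (fun e => mx2 (tV e)) b) w' w).
Proof.
elim: b w' w => [|[p e] b IHb] w' w /=.
  by rewrite kern1 => _; exact: laurent_nat.
case/andP=> lt_p wb; rewrite kernM; apply: laurent_sum => v.
by apply: laurentM; [exact: laurent_gen | exact: IHb].
Qed.

Lemma laurent_V_trace n b : braid_word n.+1 b ->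
  laurent (wtr (@hV F) ((word n.+1 (fun e => mx2 (tV e)) b : 'M[alg n]_4) 0 0)).
Proof.
move=> wb; rewrite wtr_kern; apply: laurent_sum => z; apply: laurentM.
  apply: big_ind => [|x y|q _]; [exact: laurent1|exact: laurentM|].
  rewrite /hV; case: (letter z q) => [[|[|[|[|?]]]] ?] //=;
  by repeat first [exact: laurent1 | apply: laurentN].
exact: (@laurent_word n.+1 b [tuple of ord0 :: z] [tuple of ord0 :: z]).
Qed.

End VSide.

(** * The Links--Gould side *)

Section LGSide.
Variables (F : fieldType) (s0 s1 : F).
Hypotheses (s00 : s0 != 0) (s10 : s1 != 0).
Local Notation alg := (@alg F).
Let t0 := s0 ^+ 2.
Let t1 := s1 ^+ 2.

Definition tL (u d : F) (e : bool) : tab2 F :=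
  if e then tLG s0 s1 u d else tLGi s0 s1 u d.

Lemma tL_inv u d : eqt2 (mul2 (tLG s0 s1 u d) (tLGi s0 s1 u d)) (kron id1 id1).
Proof. by check_table; field; rewrite ?s00 ?s10. Qed.

(** The Drinfeld twist identity itself. The values [u = 1 - t1] and [d = t0 - 1] factor [Y ^+ 2]
    without a square root. *)
Lemma tL_twist e :
  (1 + kr (mx1 aV) (mx1 (sV t0 t1))) * mx2 (tV t0 t1 e) =
  mx2 (twist s0 s1 (tL (1 - t1) (t0 - 1) e)) * (1 + kr (mx1 aV) (mx1 (sV t0 t1))).
Proof.
rewrite -kr11 -mx1_1 -!mx2_kron -mx2D -!mx2M; apply: eq_mx2.
rewrite /t0 /t1; case: e; rewrite /tV /tL; check_table; field;
  by rewrite ?oppr_eq0 ?oner_eq0 ?expf_eq0 /= ?s00 ?s10.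
Qed.

Definition tab_conserves (g : nat -> F) (T : tab2 F) :=
  all4 (fun i => all4 (fun j => all4 (fun k => all4 (fun l =>
    match T i j k l with Some _ => g k * g l = g i * g j | None => True end)))).

Lemma tab_conservesP g T : tab_conserves g T -> conserves (fun i : 'I_4 => g i.+1) T.
Proof.
move=> gT i j k l; have /all4P/(_ i)/all4P/(_ j)/all4P/(_ k)/all4P/(_ l) := gT.
by case: (T _ _ _ _) => //=; rewrite eqxx.
Qed.

(** Each nonzero entry keeps or swaps the two letters, or passes between the pairs {1, 4} and {2, 3}
    in the labelling of [V]. *)
Lemma tL_conserves (g : nat -> F) u d e : g 1%N * g 4%N = g 2%N * g 3%N ->
  tab_conserves g (twist s0 s1 (tL u d e)).
Proof.
move=> gE; case: e; rewrite /tab_conserves /tL; check_table;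
  first [exact: mulrC | done | exact: gE | exact/esym/gE
     | by rewrite gE mulrC | by rewrite mulrC gE | by rewrite -gE mulrC | by rewrite mulrC -gE
     | by rewrite mulrC gE mulrC | by rewrite mulrC -gE mulrC].
Qed.

Lemma chi_left i : chi s0 s1 i 3 * chi s0 s1 i 2 = chi s0 s1 i 1 * chi s0 s1 i 4.
Proof. by case: i => [|[|[|[|[|i]]]]] /=; field; rewrite ?s00 ?s10. Qed.
Lemma chi_right i : chi s0 s1 3 i * chi s0 s1 2 i = chi s0 s1 1 i * chi s0 s1 4 i.
Proof. by case: i => [|[|[|[|[|i]]]]] /=; field; rewrite ?s00 ?s10. Qed.

(** The power factor of [linked], written so that it reduces to one power of [u] or of [d] on
    numerals. *)
Fixpoint pw (u d : F) (e' e : nat) : F :=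
  match e', e with
  | e1'.+1, e1.+1 => pw u d e1' e1
  | 0, _ => d ^+ e
  | _, 0 => u ^+ e'
  end.

Lemma pwE u d e' e : pw u d e' e = u ^+ (e' - e) * d ^+ (e - e').
Proof.
by elim: e' e => [|e' IHe] [|e] //=; rewrite ?subSS ?IHe // ?sub0n ?subn0 ?expr0 ?mul1r ?mulr1.
Qed.

Definition wt4s (i j : nat) : nat :=
  match i, j with 4, 4 => 2%N | 4, _ => 1%N | _, 4 => 1%N | _, _ => 0%N end.

(* The part of [tL u d e] that depends on [u] and [d] only through [v = u * d]. *)
Definition tLcore (v : F) (e : bool) : tab2 F := fun i j k l =>
  match e, i, j, k, l with
  | true, 4, 1, 4, 1 => Some v
  | false, 1, 4, 1, 4 => Some (v / (t0 * t1))
  | _, _, _, _, _ => tL 1 1 e i j k l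
  end.

Definition pwtab (u d : F) (T : tab2 F) : tab2 F := fun i j k l =>
  omul (Some (pw u d (wt4s k l) (wt4s i j))) (T i j k l).

Lemma tL_core u d e : eqt2 (tL u d e) (pwtab u d (tLcore (u * d) e)).
Proof.
rewrite /tLcore /t0 /t1.
case: e; cbv beta iota zeta delta [pwtab tL pw wt4s]; check_table; rewrite ?expr0 ?expr1; field;
  by rewrite ?s00 ?s10.
Qed.

Lemma tL_linked u d u' d' e (i j k l : 'I_4) : u * d = u' * d' ->
  linked u d u' d' (wt4 k.+1 + wt4 l.+1) (wt4 i.+1 + wt4 j.+1)
     (odflt 0 (tL u d e i.+1 j.+1 k.+1 l.+1)) (odflt 0 (tL u' d' e i.+1 j.+1 k.+1 l.+1)).
Proof.
move=> udE; exists (odflt 0 (tLcore (u * d) e i.+1 j.+1 k.+1 l.+1)).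
have W (p q : 'I_4) : (wt4 p.+1 + wt4 q.+1)%N = wt4s p.+1 q.+1.
  by case: p q => [[|[|[|[|?]]]] ?] [[|[|[|[|?]]]] ?].
have H v v' : odflt 0 (tL v v' e i.+1 j.+1 k.+1 l.+1) =
    odflt 0 (pwtab v v' (tLcore (v * v') e) i.+1 j.+1 k.+1 l.+1).
  by apply: eqoP; have /all4P/(_ i)/all4P/(_ j)/all4P/(_ k)/all4P/(_ l) := tL_core v v' e.
by rewrite !W -!pwE !H !odflt_mul -udE.
Qed.

Lemma RLG_tab Y i j k l : RLG s0 s1 Y i j k l = odflt 0 (tLG s0 s1 Y Y i j k l).
Proof.
case: i => [|[|[|[|[|i]]]]] //; case: j => [|[|[|[|[|j]]]]] //;
case: k => [|[|[|[|[|k]]]]] //; by case: l => [|[|[|[|[|l]]]]].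
Qed.

Lemma RcoefLG Y e : mx2o (Rcoef (RLG s0 s1 Y) e) = mx2 (tL Y Y e).
Proof.
case: e; last by apply: Rcoef_inv (tL_inv Y Y) => *; exact: RLG_tab.
by apply/matrixP=> ? ?; rewrite !mxE; apply/matrixP=> ? ?; rewrite !mxE; exact: RLG_tab.
Qed.

Lemma hLG_sigma i : hLG s0 s1 (sigma i).+1 = hT t0 t1 i.+1.
Proof. by rewrite sigmaE; case: i => [[|[|[|[|?]]]] ?]. Qed.

Lemma LGinvE Y n b : Y ^+ 2 = (t0 - 1) * (1 - t1) -> braid_word n.+1 b ->
  LGinv s0 s1 Y n.+1 b = (4%:R)^-1 * (4%:R *
    wtr (@hV F) ((word n.+1 (fun e => mx2 (tV t0 t1 e)) b : 'M[alg n]_4) 0 0)).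
Proof.
move=> YE wb; rewrite /LGinv invariantE //; congr (_ * _).
have -> : word n.+1 (fun e => mx2o (Rcoef (RLG s0 s1 Y) e)) b =
          word n.+1 (fun e => mx2 (tL Y Y e)) b.
  by elim: b {wb} => //= g b ->; rewrite RcoefLG.
have udE : Y * Y = (1 - t1) * (t0 - 1) by rewrite -expr2 YE mulrC.
rewrite -closed_trace.
(* Only diagonal kernel entries occur, so [Y, Y] may be replaced by [1 - t1, t0 - 1], which have the
   same product. *)
under eq_bigr => w _.
  rewrite (linked_eq (linked_word udE w w wb (T' := tL (1 - t1) (t0 - 1)) _)); last first.
    by move=> e i j k l; exact: tL_linked.
  over.
rewrite (reindex (@sigmas n.+1)); last by apply: onW_bij; exact: sigmas_bij.
transitivity (\sum_(w : state n.+1)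
  (\prod_(q < n.+1 | (0 < (q : nat))%N) hT t0 t1 (letter w q).+1) *
   kern (word n.+1 (fun e => mx2 (twist s0 s1 (tL (1 - t1) (t0 - 1) e))) b) w w).
  apply: eq_bigr => w _; congr (_ * _).
    apply: eq_bigr => q _; rewrite -hLG_sigma /letter.
    by rewrite /sigmas /= (nth_map ord0) ?size_tuple.
  (* On a diagonal entry the two gauge factors are the same nonzero scalar and cancel. *)
  apply: (mulIf (gauge_neq0 s00 s10 w)); rewrite gauge_word // 1?mulrC // => e i.
    apply: (@tab_conservesP (fun j => chi s0 s1 (sgm i.+1) (sgm j))).
    by apply: tL_conserves; exact: chi_left.
  apply: (@tab_conservesP (fun j => chi s0 s1 (sgm j) (sgm i.+1))).
  by apply: tL_conserves; exact: chi_right.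
rewrite closed_trace.
have t00 : t0 != 0 by rewrite expf_neq0.
have t10 : t1 != 0 by rewrite expf_neq0.
under eq_bigr => i _ do rewrite (V_trace_eq t00 t10 wb tL_twist).
by rewrite sumr_const card_ord mulr_natl.
Qed.

End LGSide.

Unset Implicit Arguments.

Theorem theorem1p1 (F : fieldType) (s0 s1 Y : F) (n : nat)
    (b : seq (nat * bool)) :
  s0 != 0 -> s1 != 0 ->
  Y ^+ 2 = (s0 ^+ 2 - 1) * (1 - s1 ^+ 2) ->
  (0 < n)%N -> braid_word n b ->
  V1inv (s0 ^+ 2) (s1 ^+ 2) n b = LGinv s0 s1 Y n b /\
  exists (p : {poly {poly int}}) (k : nat),
    LGinv s0 s1 Y n b = laurent_eval p k (s0 ^+ 2) (s1 ^+ 2).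
Proof.
move=> s00 s10 YE; case: n => // n _ wb.
have t00 : s0 ^+ 2 != 0 by rewrite expf_neq0.
have t10 : s1 ^+ 2 != 0 by rewrite expf_neq0.
rewrite V1invE // (LGinvE s00 s10 YE wb); split=> //.
(* In characteristic 2 the factor 4 makes the value 0; otherwise it cancels and leaves a single
   partial trace. *)
have [E4|n4] := eqVneq (4%:R : F) 0; last first.
  by rewrite mulKf //; exact: laurent_V_trace.
by rewrite E4 mul0r mulr0; exact: laurent0.
Qed.
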